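(* Consider a $(\{b_n\},\{A_n\},0)$-Sequence where for every $n\in\mathbb{N}=\{1,2,3,\dots\}$ we have $b_n=n$ and $A_n\in\bigl\{\{0,\dots,n-1\},\{0,\dots,n\}\bigr\}$, with $\{0,1\}\subseteq A_n$. Let $\{Y_n\}_{n\ge 1}$ be the sequence of independent random variables representing the number of summands chosen from each bin, with $\mu_n=\mathbb{E}[Y_n]$, and $s_N^2=\sum_{n=1}^N\mathrm{Var}(Y_n)$. Then for every integer $\delta>0$ the Lyapunov condition $$\lim_{N\to\infty}\frac{1}{s_N^{2+\delta}}\sum_{n=1}^N\mathbb{E}\bigl[|Y_n-\mu_n|^{2+\delta}\bigr]=0$$ holds, and thus the distribution of the number of summands $Y_1+\cdots+Y_N$ converges to a Gaussian as $N\to\infty$, i.e. $\frac1{s_N}\sum_{n=1}^N(Y_n-\mu_n)$ converges in distribution to the standard normal distribution.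
   Context: The $(\{b_n\},\{A_n\},0)$-Sequence is a sequence of positive integers arranged consecutively in bins: the first $b_1$ terms form bin 1, the next $b_2$ terms form bin 2, and so on. A legal decomposition is a choice of finitely many terms such that for every $n$ the number of terms chosen from bin $n$ belongs to $A_n$ (no other restriction); it is a decomposition of the sum of the chosen terms. The sequence is constructed recursively: the first term is $1$; once the first $k$ terms have been constructed, the next term (placed in the next available position, filling the bins in order) is the least positive integer having no legal decomposition using only the first $k$ terms. Random model: from each bin $n$, independently, a subset of its $b_n$ positions with cardinality in $A_n$ is chosen uniformly at random, and $Y_n$ is its cardinality; thus the $Y_n$ are independent with $$P(Y_n=i)=\frac{\binom{b_n}{i}}{\sum_{t\in A_n}\binom{b_n}{t}}\qquad(i\in A_n).$$ *)

(* Defs.v *)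
From mathcomp Require Export all_boot all_order all_algebra finmap.
From mathcomp Require Export all_classical all_reals all_analysis.

Set Implicit Arguments.
Unset Strict Implicit.
Unset Printing Implicit Defensive.

Export Order.TTheory GRing.Theory Num.Theory.
Export numFieldNormedType.Exports.

Local Open Scope classical_set_scope.
Local Open Scope ring_scope.

(* Bins are numbered from 1, so [b 0] and [A 0] are never used; positions in
   the sequence are numbered from 0, so the first term is [a 0] and the first
   [k] terms are those at the positions in ['I_k]. *)

Definition bin_start (b : nat -> nat) (n : nat) : nat :=
  (\sum_(1 <= m < n) b m)%N.

Definition in_bin (b : nat -> nat) (n k : nat) : bool :=
  (bin_start b n <= k < bin_start b n.+1)%N.

Definition legal (b : nat -> nat) (A : nat -> set nat) (k : nat)
    (D : {set 'I_k}) : Prop :=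
  forall n, (0 < n)%N -> A n #|[pred j in D | in_bin b n j]|.

Definition legally_decomposable (b : nat -> nat) (A : nat -> set nat)
    (a : nat -> nat) (k m : nat) : Prop :=
  exists2 D : {set 'I_k}, legal b A D & m = (\sum_(j in D) a j)%N.

Definition bA0_sequence (b : nat -> nat) (A : nat -> set nat)
    (a : nat -> nat) : Prop :=
  a 0%N = 1%N /\
  forall k, (0 < k)%N ->
    [/\ (0 < a k)%N,
        ~ legally_decomposable b A a k (a k) &
        forall m, (0 < m < a k)%N -> legally_decomposable b A a k m].

Section random_model.
Context {d : measure_display} {T : measurableType d} {R : realType}.
Variable P : probability T R.

(* [S n] is the random subset chosen from bin [n]; [j : 'I_(b n)] stands for
   the position [bin_start b n + j] of the sequence. *)
Record random_choice (b : nat -> nat) (A : nat -> set nat)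
    (S : forall n, T -> {set 'I_(b n)}) : Prop := {
  random_choice_measurable : forall n (B : {set 'I_(b n)}), (0 < n)%N ->
    measurable [set t | S n t = B] ;
  random_choice_uniform : forall n (B : {set 'I_(b n)}), (0 < n)%N ->
    P [set t | S n t = B] =
      (if #|B| \in A n
       then (#|[pred C : {set 'I_(b n)} | #|C| \in A n]|%:R)^-1 else 0)%:E ;
  random_choice_independent : forall (J : {fset nat})
      (E : forall n, set {set 'I_(b n)}), (forall n, n \in J -> (0 < n)%N) ->
    P (\bigcap_(n in [set` J]) [set t | E n (S n t)]) =
      (\prod_(n <- J) P [set t | E n (S n t)])%E
}.

Definition num_chosen (b : nat -> nat) (S : forall n, T -> {set 'I_(b n)})
    (n : nat) : T -> R := fun t => #|S n t|%:R.

Definition mean (X : T -> R) : R := fine 'E_P[X]%E.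

Definition std_dev_sum (Y : nat -> T -> R) (N : nat) : R :=
  Num.sqrt (\sum_(1 <= n < N.+1) fine 'V_P[Y n]%E).

Definition lyapunov_ratio (Y : nat -> T -> R) (delta N : nat) : \bar R :=
  (((std_dev_sum Y N ^+ (2 + delta))^-1)%:E *
   \sum_(1 <= n < N.+1)
     'E_P[fun t => (`|Y n t - mean (Y n)| ^+ (2 + delta))%R])%E.

Definition normalized_sum (Y : nat -> T -> R) (N : nat) : T -> R :=
  fun t => (std_dev_sum Y N)^-1 *
           \sum_(1 <= n < N.+1) (Y n t - mean (Y n)).

Definition cvg_in_distribution (X : nat -> T -> R)
    (nu : probability (measurableTypeR R) R) : Prop :=
  forall x : R, {for x, continuous (fun y : R => nu `]-oo, y]%classic)} ->
    P [set t | X N t <= x] @[N --> \oo] --> nu `]-oo, x]%classic.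

End random_model.

(* Main.v *)
From mathcomp Require Import ring lra measurable_realfun.
Require Import Defs.

Set Implicit Arguments.
Unset Strict Implicit.
Unset Printing Implicit Defensive.

Local Open Scope classical_set_scope.
Local Open Scope ring_scope.

(** A summand [X] taking finitely many values acts on functions by the averaging
    operator [f |-> E f(. + X)], and so does a centred Gaussian. These operators
    are commuting contractions and the Gaussian ones form a semigroup, so
    replacing the summands one by one by Gaussians of the same variance
    (Lindeberg, Trotter) costs at most the sum of the one-step errors. For a
    smooth step function, Taylor's formula bounds such an error by a multiple of
    the third absolute moment, and Lyapunov's condition with [delta = 1] makes the
    total vanish. Smooth steps squeeze the distribution function.

    Here [Y_n] is a binomial variable of parameters [n] and [1/2], possibly
    conditioned on not being [n]: its variance is at least [n / 16] and its fourth
    central moment is [O(n^2)], so that [s_N] is at least [N / 6], the moment of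
    order [2 + delta] is [O(n^(delta - 1) n^(3/2))], and the Lyapunov ratio is
    [O(N^(-1/2))]. *)

(** * Smooth steps *)

Section cubic_step.
Context {R : realType}.
Implicit Types x h c e C L : R.

Definition pospart x : R := if 0 <= x then x else 0.

(** The second derivative [pospart] of the truncated cube is 1-Lipschitz, which accounts for the
    remainder. Each sign pattern of [x] and [x + h] reduces to a polynomial inequality. *)
Lemma pospart_taylor x h :
  `|pospart (x + h) ^+ 3 / 6 - pospart x ^+ 3 / 6
    - h * (pospart x ^+ 2 / 2) - h ^+ 2 / 2 * pospart x| <= `|h| ^+ 3 / 6.
Proof.
have le3 (a b : R) : 0 <= a -> a <= b -> a ^+ 3 <= b ^+ 3.
  by move=> a0 ab; rewrite lerXn2r ?nnegrE//; lra.
have nh3 : - `|h| ^+ 3 / 6 <= h ^+ 3 / 6 <= `|h| ^+ 3 / 6.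
  have := ler_norm (h ^+ 3); have := ler_norm (- h ^+ 3).
  by rewrite normrN normrX => ? ?; apply/andP; split; lra.
case/andP: nh3 => n1 n2; have n0 := exprn_ge0 3 (normr_ge0 h).
rewrite /pospart ler_norml.
case: (lerP 0 (x + h)) => xh; case: (lerP 0 x) => x0.
- have -> : (x + h) ^+ 3 / 6 - x ^+ 3 / 6 - h * (x ^+ 2 / 2) - h ^+ 2 / 2 * x
    = h ^+ 3 / 6 by field.
  by apply/andP; split; lra.
- have := le3 (x + h) h xh ltac:(lra); have := exprn_ge0 3 xh.
  by move: ((x + h) ^+ 3) => a ? ?; apply/andP; split; lra.
- have := le3 (- (x + h)) (- h) ltac:(lra) ltac:(lra).
  have := @exprn_ge0 _ 3 (- (x + h)) ltac:(lra).
  have N3 (a : R) : (- a) ^+ 3 = - a ^+ 3 by ring.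
  rewrite !N3 => ? ?.
  have -> : 0 ^+ 3 / 6 - x ^+ 3 / 6 - h * (x ^+ 2 / 2) - h ^+ 2 / 2 * x
    = h ^+ 3 / 6 - (x + h) ^+ 3 / 6 by field.
  by apply/andP; split; lra.
- by apply/andP; split; lra.
Qed.

(** Third differences kill polynomials of degree at most 2 and send [x ^+ 3 / 6] to 1, so the
    truncated cube becomes 0 to the left of 0 and 1 to the right of 3. *)
Definition third_diff (q : R -> R) x : R :=
  q x - 3 * q (x - 1) + 3 * q (x - 2) - q (x - 3).

(* The distribution function of the sum of three independent uniform variables
   on [0, 1]. *)
Definition cubic_step : R -> R := third_diff (fun x => pospart x ^+ 3 / 6).
Let step1 : R -> R := third_diff (fun x => pospart x ^+ 2 / 2).
Let step2 : R -> R := third_diff pospart.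

(** The coefficients of [third_diff] add up to 8 in absolute value, so the four remainders give
    [8 / 6], rounded up to 2. *)
Lemma cubic_step_taylor x h :
  `|cubic_step (x + h) - cubic_step x - h * step1 x - h ^+ 2 / 2 * step2 x|
    <= 2 * `|h| ^+ 3.
Proof.
have H y := pospart_taylor y h.
move: (H x) (H (x - 1)) (H (x - 2)) (H (x - 3)).
rewrite /cubic_step /step1 /step2 /third_diff !(addrAC x h).
move: (pospart (x + h)) (pospart x) (pospart (x - 1 + h)) (pospart (x - 1))
  (pospart (x - 2 + h)) (pospart (x - 2)) (pospart (x - 3 + h))
  (pospart (x - 3)) => a a' b b' c c' d d'.
have := exprn_ge0 3 (normr_ge0 h); move: (`|h| ^+ 3) => k k0.
rewrite !ler_norml => /andP[? ?] /andP[? ?] /andP[? ?] /andP[? ?].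
apply/andP; split; lra.
Qed.

(** The pieces between the knots 0, 1, 2, 3 in a local coordinate [u]; the last one is measured
    backwards from 3, where it is simplest. *)
Lemma cubic_stepE x :
  [\/ [/\ x <= 0, cubic_step x = 0, step1 x = 0 & step2 x = 0],
      exists2 u, 0 <= u <= 1 & [/\ x = u, cubic_step x = u ^+ 3 / 6,
        step1 x = u ^+ 2 / 2 & step2 x = u],
      exists2 u, 0 <= u <= 1 & [/\ x = 1 + u,
        cubic_step x = (1 + 3 * u + 3 * u ^+ 2 - 2 * u ^+ 3) / 6,
        step1 x = (1 + 2 * u - 2 * u ^+ 2) / 2 & step2 x = 1 - 2 * u] |
      (exists2 u, 0 <= u & [/\ x = 3 - u,
        cubic_step x = 1 - u ^+ 3 / 6,
        step1 x = u ^+ 2 / 2, step2 x = - u & u <= 1]) \/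
      [/\ 3 <= x, cubic_step x = 1, step1 x = 0 & step2 x = 0]].
Proof.
rewrite /cubic_step /step1 /step2 /third_diff /pospart.
have [x0|x0] := lerP 0 x; last first.
  have [|_] := lerP 0 (x - 1); first lra.
  have [|_] := lerP 0 (x - 2); first lra.
  have [|_] := lerP 0 (x - 3); first lra.
  by constructor 1; split; [exact: ltW|field..].
have [x1|x1] := lerP 0 (x - 1); last first.
  have [|_] := lerP 0 (x - 2); first lra.
  have [|_] := lerP 0 (x - 3); first lra.
  by constructor 2; exists x; [apply/andP; split; lra|split; field].
have [x2|x2] := lerP 0 (x - 2); last first.
  have [|_] := lerP 0 (x - 3); first lra.
  by constructor 3; exists (x - 1); [apply/andP; split; lra|split; field].
have [x3|x3] := lerP 0 (x - 3); constructor 4; last first.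
  by left; exists (3 - x); [lra|split; by [field|lra]].
by right; split; by [lra|field].
Qed.

Lemma cubic_step_bounds x :
  [/\ 0 <= cubic_step x <= 1, `|step1 x| <= 1 & `|step2 x| <= 1].
Proof.
rewrite !ler_norml.
case: (cubic_stepE x) => [[_ -> -> ->]|[u /andP[? ?]] [_ -> -> ->]|
    [u /andP[? ?]] [_ -> -> ->]|[[u ?] [_ -> -> -> ?]|[_ -> -> ->]]];
  by split; apply/andP; split; nra.
Qed.

Lemma cubic_step0 x : x <= 0 -> cubic_step x = 0.
Proof.
move=> x0; case: (cubic_stepE x) => [[]//|[u /andP[? ?]] [? -> _ _]|
    [u /andP[? ?]] [? _ _ _]|[[u ?] [? _ _ _ ?]|[? _ _ _]]]; try lra.
have -> : u = 0 by lra.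
by field.
Qed.

Lemma cubic_step1 x : 3 <= x -> cubic_step x = 1.
Proof.
move=> x0; case: (cubic_stepE x) => [[? _ _ _]|[u /andP[? ?]] [? _ _ _]|
    [u /andP[? ?]] [? _ _ _]|[[u ?] [? -> _ _ ?]|[? -> _ _//]]]; try lra.
have -> : u = 0 by lra.
by field.
Qed.

(** When |h| is at least 1, it is enough that the values lie in [0, 1]. Otherwise the Taylor
    contributions are at most |h|, |h| and 2|h|, whence the constant 4. *)
Lemma cubic_step_lip x y : `|cubic_step x - cubic_step y| <= 4 * `|x - y|.
Proof.
pose h := x - y; have -> : x = y + h by rewrite /h; ring.
have -> : y + h - y = h by ring.
have := cubic_step_taylor y h.
have [/andP[? ?] _ _] := cubic_step_bounds (y + h).
have [/andP[? ?] b1 b2] := cubic_step_bounds y.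
have [h1|h1] := lerP 1 `|h|.
  by move=> _; rewrite ler_norml; apply/andP; split; lra.
have h0 := normr_ge0 h.
have : `|h * step1 y| <= `|h| by rewrite normrM ler_piMr.
have : `|h ^+ 2 / 2 * step2 y| <= `|h|.
  rewrite normrM normf_div normrX (ger0_norm (ler0n _ 2)).
  move: (`|h|) (`|step2 y|) (normr_ge0 (step2 y)) h0 h1 b2 => k l *.
  by apply: (@le_trans _ _ (k * 1)); [nra|rewrite mulr1].
have h3 : `|h| ^+ 3 <= `|h|.
  by rewrite -[leRHS]expr1; apply: ler_wiXn2l => //; exact: ltW.
move: (h * step1 y) (h ^+ 2 / 2 * _) (`|h| ^+ 3) h3 => a b c ?.
by rewrite !ler_norml => /andP[? ?] /andP[? ?] /andP[? ?]; apply/andP; split; lra.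
Qed.

(** Smoothness is recorded as a uniform expansion, the form in which it gets averaged, rather than
    through derivatives. *)
Definition taylor3 (C : R) (f : R -> R) : Prop :=
  exists f1 f2 : R -> R, forall x h,
    `|f (x + h) - f x - h * f1 x - h ^+ 2 / 2 * f2 x| <= C * `|h| ^+ 3.

(** The bounds give integrability and the Lipschitz condition gives measurability; both pass through
    the averaging operators with the same constants. *)
Definition unit_lipschitz (L : R) (f : R -> R) : Prop :=
  (forall x, 0 <= f x <= 1) /\ (forall x y, `|f x - f y| <= L * `|x - y|).

(** A smooth decreasing step, from 1 at [c - 3 * e] down to 0 at [c]. *)
Definition step_at c e x : R := cubic_step ((c - x) / e).

Lemma step_at_taylor3 c e : 0 < e -> taylor3 (2 * e ^- 3) (step_at c e).
Proof.
move=> e0; exists (fun x => - e^-1 * step1 ((c - x) / e)),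
  (fun x => e ^- 2 * step2 ((c - x) / e)) => x h.
have := cubic_step_taylor ((c - x) / e) (- (h / e)).
have -> : (c - x) / e - h / e = (c - (x + h)) / e.
  by rewrite -mulrBl; congr (_ / _); ring.
rewrite normrN normrM (gtr0_norm (_ : 0 < e^-1)) ?invr_gt0// exprMn.
rewrite /step_at -!exprVn.
move: (cubic_step _) (cubic_step _) (step1 _) (step2 _) => a b c1 c2.
have -> : 2 * (`|h| ^+ 3 * e^-1 ^+ 3) = 2 * e^-1 ^+ 3 * `|h| ^+ 3 by ring.
move=> H; apply: le_trans H; rewrite le_eqVlt; apply/orP; left; apply/eqP.
by congr (`| _ |); ring.
Qed.

Lemma step_at_lip c e : 0 < e -> unit_lipschitz (4 / e) (step_at c e).
Proof.
move=> e0; split=> [x|x y]; first by have [] := cubic_step_bounds ((c - x) / e).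
apply: le_trans (cubic_step_lip _ _) _.
rewrite -mulrBl normrM (gtr0_norm (_ : 0 < e^-1)) ?invr_gt0//.
have -> : c - x - (c - y) = - (x - y) by ring.
by rewrite normrN le_eqVlt; apply/orP; left; apply/eqP; ring.
Qed.

Lemma step_at_le c e x : 0 < e -> step_at c e x <= (x <= c)%R%:R.
Proof.
move=> e0; case: (lerP x c) => xc.
  by have [/andP[]] := cubic_step_bounds ((c - x) / e).
by rewrite /step_at cubic_step0// pmulr_lle0 ?invr_gt0// subr_le0 ltW.
Qed.

Lemma step_at_ge c e x : 0 < e -> (x <= c - 3 * e)%R%:R <= step_at c e x.
Proof.
move=> e0; case: (lerP x (c - 3 * e)) => xc; last first.
  by have [/andP[]] := cubic_step_bounds ((c - x) / e).
by rewrite /step_at cubic_step1// ler_pdivlMr//; lra.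
Qed.

End cubic_step.

(** * Gaussian integrals *)

Section gaussian_integral.
Context {R : realType}.
Notation mu := (@lebesgue_measure R).
Implicit Types f g : R -> R.

Local Notation phi := (normal_pdf (0 : R) 1).

Definition gint f : R := (\int[mu]_z (f z * phi z))%R.
Definition gintegrable f : Prop :=
  mu.-integrable setT (EFin \o (fun z => f z * phi z)).

Lemma gintegrableD f g : gintegrable f -> gintegrable g ->
  gintegrable (fun z => f z + g z).
Proof.
move=> If Ig; rewrite /gintegrable.
rewrite (_ : EFin \o _ = (fun z => (f z * phi z)%:E + (g z * phi z)%:E)%E).
  exact: integrableD.
by apply/funext => z /=; rewrite mulrDl EFinD.
Qed.

Lemma gintegrableZ (k : R) f : gintegrable f -> gintegrable (fun z => k * f z).
Proof.
move=> If; rewrite /gintegrable.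
rewrite (_ : EFin \o _ = (fun z => k%:E * (f z * phi z)%:E)%E).
  exact: integrableZl.
by apply/funext => z /=; rewrite -mulrA EFinM.
Qed.

Lemma gintegrable_cst (k : R) : gintegrable (fun=> k).
Proof.
rewrite /gintegrable.
rewrite (_ : EFin \o _ = (fun z => k%:E * (phi z)%:E)%E) //.
by apply: integrableZl => //; exact: integrable_normal_pdf.
Qed.

Lemma le_gintegrable f g : measurable_fun setT f ->
  (forall z, `|f z| <= g z) -> gintegrable g -> gintegrable f.
Proof.
move=> mf fg; apply: le_integrable => //.
  by apply/measurable_EFinP/measurable_funM => //; exact: measurable_normal_pdf.
move=> z _ /=; rewrite lee_fin !normrM ler_wpM2r//.
by apply: le_trans (fg z) _; exact: ler_norm.
Qed.

Lemma gintD f g : gintegrable f -> gintegrable g ->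
  gint (fun z => f z + g z) = gint f + gint g.
Proof.
move=> If Ig; rewrite /gint -RintegralD//.
by apply: eq_Rintegral => z _; rewrite mulrDl.
Qed.

Lemma gintZ (k : R) f : gintegrable f -> gint (fun z => k * f z) = k * gint f.
Proof.
move=> If; rewrite /gint -RintegralZl//.
by apply: eq_Rintegral => z _; rewrite mulrA.
Qed.

Lemma gintB f g : gintegrable f -> gintegrable g ->
  gint (fun z => f z - g z) = gint f - gint g.
Proof.
move=> If Ig; rewrite /gint -RintegralB//.
by apply: eq_Rintegral => z _; rewrite mulrBl.
Qed.

Lemma gint_cst (k : R) : gint (fun=> k) = k.
Proof.
rewrite /gint RintegralZl//; last exact: integrable_normal_pdf.
by rewrite /Rintegral integral_normal_pdf /= mulr1.
Qed.

Lemma le_gint f g : gintegrable f -> gintegrable g ->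
  (forall z, f z <= g z) -> gint f <= gint g.
Proof.
move=> If Ig fg; apply: le_Rintegral => // z _.
by apply: ler_wpM2r => //; exact: normal_pdf_ge0.
Qed.

Lemma ler_norm_gint f g : gintegrable f -> gintegrable g ->
  (forall z, `|f z| <= g z) -> `|gint f| <= gint g.
Proof.
move=> If Ig fg; rewrite ler_norml; apply/andP; split.
  rewrite -mulN1r -gintZ//; apply: le_gint => //; first exact: gintegrableZ.
  by move=> z; have := fg z; rewrite ler_norml => /andP[]; rewrite mulN1r.
by apply: le_gint => // z; exact: le_trans (ler_norm _) (fg z).
Qed.

Lemma eq_gint f g : f =1 g -> gint f = gint g.
Proof. by move=> /funext->. Qed.

Lemma gint_sum (I : Type) (r : seq I) (k : I -> R) (F : I -> R -> R) :
  (forall i, gintegrable (F i)) ->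
  gintegrable (fun z => \sum_(i <- r) k i * F i z) /\
  gint (fun z => \sum_(i <- r) k i * F i z) = \sum_(i <- r) k i * gint (F i).
Proof.
move=> IF; elim: r => [|i r [Ir Er]].
  rewrite big_nil; under eq_fun do rewrite big_nil.
  by split; [exact: gintegrable_cst|exact: gint_cst].
rewrite big_cons; under eq_fun do rewrite big_cons.
have Ii := gintegrableZ (k i) (IF i).
by split; [exact: gintegrableD|rewrite gintD// gintZ// Er].
Qed.

(** Exponential tilting: when the weight [f] turns [phi] into a multiple of another normal density,
    the total mass 1 of that density yields the integral. *)
Lemma gint_normal_pdf (m s c : R) f : s != 0 ->
  (forall z, f z * phi z = c * normal_pdf m s z) ->
  gintegrable f /\ gint f = c.
Proof.
move=> s0 E; rewrite /gintegrable /gint.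
have -> : (fun z => f z * phi z) = (fun z => c * normal_pdf m s z) by apply/funext.
split.
  rewrite (_ : EFin \o _ = (fun z => c%:E * (normal_pdf m s z)%:E)%E) //.
  by apply: integrableZl => //; exact: integrable_normal_pdf.
rewrite RintegralZl//; last exact: integrable_normal_pdf.
by rewrite /Rintegral integral_normal_pdf /= mulr1.
Qed.

Lemma normal_peakE (s : R) : 0 < s ->
  normal_peak s = s^-1 * normal_peak (1 : R).
Proof.
move=> s0; rewrite /normal_peak expr1n mul1r -mulrnAr sqrtrM ?sqr_ge0//.
by rewrite sqrtr_sqr gtr0_norm// invfM.
Qed.

Lemma normal_pdf1 (m s z : R) : 0 < s ->
  normal_pdf m s z = s^-1 * normal_peak (1 : R) *
    expR (- (z - m) ^+ 2 / (2 * s ^+ 2)).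
Proof.
move=> s0; rewrite normal_pdfE ?lt0r_neq0// normal_peakE// /normal_fun.
by rewrite mulr_natl.
Qed.

(** The weight changes the standard deviation from 1 to [s]; the value is the ratio of the two
    peaks. *)
Lemma gint_expR_sqr (s : R) : 0 < s ->
  let f := fun z : R => expR (- ((s ^- 2 - 1) / 2 * z ^+ 2)) in
  gintegrable f /\ gint f = s.
Proof.
move=> s0 f; apply: (@gint_normal_pdf 0 s); first exact: lt0r_neq0.
move=> z; rewrite !normal_pdf1// /f invr1 mul1r !mulrA mulfV ?lt0r_neq0// mul1r.
rewrite -mulrA mulrCA -expRD; congr (_ * expR _).
by field; exact: lt0r_neq0.
Qed.

(** Completing the square moves the mean from 0 to [a]. *)
Lemma gint_expR_lin (a : R) :
  let f := fun z : R => expR (a * z) in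
  gintegrable f /\ gint f = expR (a ^+ 2 / 2).
Proof.
move=> f; apply: (@gint_normal_pdf a 1); first exact: oner_neq0.
move=> z; rewrite !normal_pdf1// /f invr1 mul1r mulrCA [in RHS]mulrCA.
rewrite -!expRD; congr (_ * expR _).
by field.
Qed.

(** With deviation [Num.sqrt 2] the integrable weight is the exponential of [z ^+ 2 / 4]. It is the
    square of a quantity at least [1 + z ^+ 2 / 8], so 64 times it dominates [64 + z ^+ 4]. *)
Lemma gintegrable_moment f : measurable_fun setT f ->
  (forall z, `|f z| <= 64 + z ^+ 4) -> gintegrable f.
Proof.
move=> mf fz.
have [+ _] := @gint_expR_sqr (Num.sqrt 2) ltac:(by rewrite sqrtr_gt0 ltr0n).
move/(gintegrableZ 64); apply: le_gintegrable => // z.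
apply: le_trans (fz z) _; rewrite sqr_sqrtr ?ler0n//.
have -> : - ((2^-1 - 1) / 2 * z ^+ 2) = z ^+ 2 / 8 + z ^+ 2 / 8 :> R by field.
rewrite expRD; have := expR_ge1Dx (z ^+ 2 / 8); have := sqr_ge0 z.
rewrite (_ : z ^+ 4 = (z ^+ 2) ^+ 2); last by rewrite -exprM.
by move: (expR (z ^+ 2 / 8)) (z ^+ 2) => u v *; nra.
Qed.

Lemma gintegrable_id : gintegrable (fun z => z).
Proof.
apply: gintegrable_moment => // z.
rewrite (_ : z ^+ 4 = `|z| ^+ 4); last by rewrite -normrX ger0_norm// exprn_even_ge0.
have := sqr_ge0 (`|z| ^+ 2 - 1 / 2); have := sqr_ge0 (`|z| - 1 / 2).
by rewrite !sqrrB -exprM; lra.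
Qed.

Lemma gintegrable_sqr : gintegrable (fun z => z ^+ 2).
Proof.
apply: gintegrable_moment; first exact: measurable_funX.
move=> z; rewrite ger0_norm ?sqr_ge0//.
rewrite (_ : z ^+ 4 = (z ^+ 2) ^+ 2); last by rewrite -exprM.
by move: (z ^+ 2) (sqr_ge0 z) => u u0; nra.
Qed.

Lemma gintegrable_cube : gintegrable (fun z => `|z| ^+ 3).
Proof.
apply: gintegrable_moment.
  by apply: measurable_funX; exact: normr_measurable.
move=> z; rewrite ger0_norm ?exprn_ge0//.
rewrite (_ : z ^+ 4 = `|z| ^+ 4); last by rewrite -normrX ger0_norm// exprn_even_ge0.
move: (`|z|) (normr_ge0 z) => u u0; have [u1|u1] := lerP u 1.
  have := exprn_ge0 4 u0; have := exprn_ile1 3 u0 u1; lra.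
by rewrite (exprSr u 3); have := exprn_ge0 3 u0; move: (u ^+ 3) => ? ?; nra.
Qed.

(** Integrating [1 + a * z <= expR (a * z)] bounds [1 + a * m] by [expR (a ^+ 2 / 2)], itself at
    most the inverse of [1 - a ^+ 2 / 2]. The left side is linear in [a] and the excess on the right
    is quadratic, which forces [m = 0]. *)
Lemma gint_id : gint (fun z => z) = 0.
Proof.
set m := gint _.
have H (a : R) : a ^+ 2 < 1 -> a * m * (1 - a ^+ 2 / 2) <= a ^+ 2 / 2.
  move=> a1; have [If Ef] := gint_expR_lin a.
  have Iid := gintegrableZ a gintegrable_id.
  have Ia := gintegrableD (gintegrable_cst 1) Iid.
  have := le_gint Ia If (fun z => expR_ge1Dx _).
  rewrite Ef (gintD (gintegrable_cst 1) Iid) gint_cst (gintZ _ gintegrable_id).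
  have := expR_ge1Dx (- (a ^+ 2 / 2)); rewrite expRN.
  have := expR_gt0 (a ^+ 2 / 2); rewrite -/m.
  move: (expR _) => u u0; rewrite -[u^-1]mul1r ler_pdivlMr// => h1 h2.
  have h3 : 0 <= 1 - a ^+ 2 / 2 by lra.
  have := ler_wpM2r h3 h2; rewrite [X in _ <= X]mulrC => /le_trans/(_ h1); lra.
(* The bound is tested at [a = m / 2] for small [m], and otherwise at [1 / 2] with the sign of
   [m]. *)
have [m1|m1] := lerP (m ^+ 2) 1.
  have := H (m / 2); rewrite exprMn exprVn.
  have -> : m / 2 * m = m ^+ 2 / 2 by field.
  move=> /(_ ltac:(lra)) Hm; apply/eqP; rewrite -sqrf_eq0 eq_le sqr_ge0 andbT.
  have := sqr_ge0 m; move: (m ^+ 2) m1 Hm => q ? ? ?; nra.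
exfalso; have [m0|m0] := lerP 0 m.
- have := H (1 / 2) ltac:(lra); nra.
- have := H (- (1 / 2)) ltac:(lra); nra.
Qed.

(* Integrating [1 - u <= expR (- u)] against the density, with
   [u = (s ^- 2 - 1) / 2 * z ^+ 2] and [s] on both sides of 1, pins the second
   moment down. *)
Lemma gint_sqr : gint (fun z => z ^+ 2) = 1.
Proof.
set V := gint _.
have H (s : R) : 0 < s -> (1 - s) * (2 * s ^+ 2) <= (1 - s) * (1 + s) * V.
  move=> s0; have [If Ef] := gint_expR_sqr s0.
  have I2 := gintegrableZ (- ((s ^- 2 - 1) / 2)) gintegrable_sqr.
  have Is := gintegrableD (gintegrable_cst 1) I2.
  have le1 (z : R) : 1 + - ((s ^- 2 - 1) / 2) * z ^+ 2 <=
      expR (- ((s ^- 2 - 1) / 2 * z ^+ 2)) by rewrite mulNr; exact: expR_ge1Dx.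
  have := le_gint Is If le1; rewrite Ef (gintD (gintegrable_cst 1) I2) gint_cst.
  rewrite (gintZ _ gintegrable_sqr) -/V.
  have s2 : 0 < 2 * s ^+ 2 by rewrite mulr_gt0// exprn_gt0.
  move/(ler_wpM2l (ltW s2)).
  have -> : 2 * s ^+ 2 * (1 + - ((s ^- 2 - 1) / 2) * V) =
    2 * s ^+ 2 - (1 - s) * (1 + s) * V by field; exact: lt0r_neq0.
  by lra.
have V0 : 0 <= V.
  rewrite -[leLHS](gint_cst 0); apply: le_gint; [exact: gintegrable_cst|
    exact: gintegrable_sqr|move=> z; exact: sqr_ge0].
apply/eqP; rewrite eq_le; apply/andP; split; rewrite leNgt; apply/negP => V1.
(* In both cases [s] lies strictly between 1 and [V], and [H s] makes the strictly positive product
   displayed below nonpositive. *)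
- pose s := (V + 3) / 4; have Vs : V = 4 * s - 3 by rewrite /s; field.
  have := H s ltac:(lra); rewrite Vs.
  have : 0 < (s - 1) ^+ 2 * (2 * s + 3) by rewrite mulr_gt0 ?exprn_gt0; lra.
  by lra.
- pose s := (V + 1) / 2; have Vs : V = 2 * s - 1 by rewrite /s; field.
  have := H s ltac:(lra); rewrite Vs.
  have : 0 < (s - 1) ^+ 2 * 1 by rewrite mulr1 exprn_even_gt0//= subr_eq0; apply/eqP; lra.
  by lra.
Qed.

End gaussian_integral.

(** * The Gaussian semigroup *)

Section gaussian_operator.
Context {R : realType}.
Notation mu := (@lebesgue_measure R).
Implicit Types f g : R -> R.
Local Notation phi := (normal_pdf (0 : R) 1).

Lemma unit_lipschitz_continuous (L : R) f : unit_lipschitz L f -> continuous f.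
Proof.
move=> [_ fL] x; apply/cvgrPdist_le => e e0.
have L1 : 0 < `|L| + 1 by rewrite ltr_pwDr.
near=> y.
apply: le_trans (fL x y) _.
apply: (@le_trans _ _ ((`|L| + 1) * `|x - y|)).
  rewrite ler_wpM2r//; apply: le_trans (ler_norm L) _; lra.
rewrite mulrC -ler_pdivlMr//; near: y.
by apply: cvgr_dist_le; [exact: cvg_id|rewrite divr_gt0].
Unshelve. all: by end_near. Qed.

Definition gauss_op (s : R) f x : R := gint (fun z => f (x + s * z)).

Lemma unit_lipschitz_measurable (L s x : R) f : unit_lipschitz L f ->
  measurable_fun setT (fun z => f (x + s * z)).
Proof.
move=> /unit_lipschitz_continuous/continuous_measurable_fun mf.
apply: (measurableT_comp mf).
by apply: measurable_funD => //; apply: measurable_funM.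
Qed.

Lemma unit_lipschitz_gintegrable (L s x : R) f : unit_lipschitz L f ->
  gintegrable (fun z => f (x + s * z)).
Proof.
move=> fL; apply: (le_gintegrable _ _ (gintegrable_cst 1)).
  exact: unit_lipschitz_measurable fL.
by move=> z; have /andP[? ?] := fL.1 (x + s * z); rewrite ger0_norm.
Qed.

Lemma unit_lipschitz_gauss_op (L s : R) f : unit_lipschitz L f ->
  unit_lipschitz L (gauss_op s f).
Proof.
move=> fL; split=> [x|x y].
  have I := unit_lipschitz_gintegrable s x fL; apply/andP; split.
    rewrite -[leLHS](gint_cst 0); apply: le_gint => //.
      exact: gintegrable_cst.
    by move=> z; have /andP[] := fL.1 (x + s * z).
  rewrite -[leRHS](gint_cst 1); apply: le_gint => //.
    exact: gintegrable_cst.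
  by move=> z; have /andP[] := fL.1 (x + s * z).
have Ix := unit_lipschitz_gintegrable s x fL.
have Iy := unit_lipschitz_gintegrable s y fL.
rewrite /gauss_op -gintB// -[leRHS]gint_cst; apply: ler_norm_gint.
- have := gintegrableD Ix (gintegrableZ (-1) Iy).
  by under eq_fun do rewrite mulN1r.
- exact: gintegrable_cst.
- move=> z; apply: le_trans (fL.2 _ _) _.
  by have -> : x + s * z - (y + s * z) = x - y by ring.
Qed.

Lemma gauss_op0 f x : gauss_op 0 f x = f x.
Proof.
rewrite /gauss_op (_ : (fun z => _) = (fun=> f x)) ?gint_cst//.
by apply/funext => z; rewrite mul0r addr0.
Qed.

Lemma integral_affine (G : R -> R) (a c : R) : 0 < a -> continuous G ->
  (forall x, 0 <= G x) ->
  (\int[mu]_x (G x)%:E = \int[mu]_x (G ((x + c) * a) * a)%:E)%E.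
Proof.
move=> a0 cG G0; pose F (x : R^o) : R^o := (x + c) * a.
have F'E : F^`()%classic = cst a.
  apply/funext => x; rewrite /F derive1E deriveM// deriveD// derive_cst scaler0.
  by rewrite add0r derive_id derive_cst addr0 scaler1.
rewrite (@increasing_ge0_integration_by_substitutionT _ F G)//.
- by apply: eq_integral => x _; rewrite F'E.
- by move=> x y xy; rewrite /F ltr_pM2r// ltrD2r.
- by rewrite F'E => ?; exact: cvg_cst.
- by rewrite F'E; exact: is_cvg_cst.
- by rewrite F'E; exact: is_cvg_cst.
- by apply/gt0_cvgMlNy => //; exact: cvg_addrr_Ny.
- by apply/gt0_cvgMly => //; exact: cvg_addrr.
Qed.

(* The joint density of two independent Gaussians factors as the density of
   their (normalised) sum [w] times the conditional density of [y]. *)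
Lemma gaussian_disintegration (s t r w y : R) : 0 < t -> 0 < r ->
  r ^+ 2 = s ^+ 2 + t ^+ 2 ->
  phi ((w + - (s * y / r)) * (r / t)) * (r / t) * phi y =
  phi w * normal_pdf (s * w / r) (t / r) y.
Proof.
move=> t0 r0 rst; rewrite !normal_pdf1// ?divr_gt0//.
have [t0' r0'] := (lt0r_neq0 t0, lt0r_neq0 r0).
set k := normal_peak 1; rewrite invr1 !mul1r invf_div.
rewrite [LHS](_ : _ = k * k * (r / t) *
  (expR (- ((w - s * y / r) * (r / t) - 0) ^+ 2 / (2 * 1 ^+ 2))
  * expR (- (y - 0) ^+ 2 / (2 * 1 ^+ 2)))); last by ring.
rewrite [RHS](_ : _ = k * k * (r / t) * (expR (- (w - 0) ^+ 2 / (2 * 1 ^+ 2))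
  * expR (- (y - s * w / r) ^+ 2 / (2 * (t / r) ^+ 2)))); last by ring.
rewrite -!expRD; congr (_ * expR _).
have e1 : ((w - s * y / r) * (r / t)) ^+ 2 = (r * w - s * y) ^+ 2 / t ^+ 2.
  by field; rewrite t0' r0'.
have e2 : (y - s * w / r) ^+ 2 / (2 * (t / r) ^+ 2) =
    (r ^+ 2 * y ^+ 2 - 2 * r * s * w * y + s ^+ 2 * w ^+ 2) / (2 * t ^+ 2).
  by field; rewrite t0' r0'.
rewrite !subr0 e1 !mulNr e2 expr1n mulr1.
have -> : (r * w - s * y) ^+ 2 =
  r ^+ 2 * w ^+ 2 - 2 * r * s * w * y + s ^+ 2 * y ^+ 2 by ring.
by rewrite rst; field.
Qed.

(** The inner variable is replaced by the normalised sum [w] of the two Gaussians, Tonelli exchanges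
    the integrals, and the conditional density of [y] given [w] integrates to 1. *)
Lemma gauss_op_semigroup (L s t x : R) f : 0 < t -> unit_lipschitz L f ->
  gauss_op s (gauss_op t f) x = gauss_op (Num.sqrt (s ^+ 2 + t ^+ 2)) f x.
Proof.
move=> t0 fL; set r := Num.sqrt _.
have r0 : 0 < r by rewrite sqrtr_gt0 ltr_pwDr ?sqr_ge0// exprn_gt0.
have r2 : r ^+ 2 = s ^+ 2 + t ^+ 2 by rewrite sqr_sqrtr// addr_ge0// sqr_ge0.
have cf := unit_lipschitz_continuous fL.
have f0 z : 0 <= f z by have /andP[] := fL.1 z.
have phi0 z : 0 <= phi z by exact: normal_pdf_ge0.
have rt0 : 0 < r / t by rewrite divr_gt0.
have cphi : continuous phi by apply: continuous_normal_pdf; exact: oner_neq0.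
rewrite [LHS]/gauss_op /gint /Rintegral; congr fine.
pose h (p : R * R) : \bar R := (f (x + r * p.2) *
  (phi ((p.2 + - (s * p.1 / r)) * (r / t)) * (r / t) * phi p.1))%:E.
have mh : measurable_fun setT h.
  apply/measurable_EFinP/measurable_funM.
    apply: (measurableT_comp (unit_lipschitz_measurable r x fL)).
    exact: measurable_snd.
  have mphi : measurable_fun setT phi by exact: measurable_normal_pdf.
  apply: measurable_funM; last by apply: (measurableT_comp mphi measurable_fst).
  apply: measurable_funM => //; apply: (measurableT_comp mphi).
  apply: measurable_funM => //; apply: measurable_funD.
    exact: measurable_snd.
  apply: measurableT_comp => //; apply: measurable_funM => //.
  by apply: measurable_funM => //; exact: measurable_fst.
have h0 p : (0 <= h p)%E.
  by rewrite lee_fin mulr_ge0// mulr_ge0// mulr_ge0// ltW.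
transitivity (\int[mu]_y \int[mu]_w h (y, w))%E.
  apply: eq_integral => y _.
  have If := unit_lipschitz_gintegrable t (x + s * y) fL.
  rewrite EFinM /gauss_op /gint /Rintegral fineK; last exact: integrable_fin_num If.
  (* The inner variable [z] becomes [(w - s * y / r) * (r / t)], so that [s * y + t * z = r * w]. *)
  rewrite (integral_affine (- (s * y / r)) rt0); first last.
  - by move=> z; exact: mulr_ge0.
  - move=> z; apply: cvgM; last exact: cphi.
    apply: (cvg_comp (fun z => x + s * y + t * z) f); last exact: cf.
    by apply: cvgD; [exact: cvg_cst|apply: cvgM; [exact: cvg_cst|exact: cvg_id]].
  rewrite -ge0_integralZr//=; first last.
  - by rewrite lee_fin.
  - by move=> z _; rewrite lee_fin; apply: mulr_ge0; [exact: mulr_ge0|exact: ltW].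
  - apply/measurable_EFinP/measurable_funM => //; apply: measurable_funM.
      apply: (measurableT_comp (unit_lipschitz_measurable t (x + s * y) fL)).
      by apply: measurable_funM => //; exact: measurable_funD.
    apply: measurableT_comp; first exact: measurable_normal_pdf.
    by apply: measurable_funM => //; exact: measurable_funD.
  apply: eq_integral => w _; rewrite /h -EFinM /=.
  have -> : x + s * y + t * ((w + - (s * y / r)) * (r / t)) = x + r * w.
    by field; rewrite !lt0r_neq0.
  by rewrite !mulrA.
have E := @fubini_tonelli _ _ _ _ R mu mu h mh h0.
rewrite [LHS]E; apply: eq_integral => w _.
transitivity (\int[mu]_y ((f (x + r * w) * phi w)%:E *
    (normal_pdf (s * w / r) (t / r) y)%:E))%E.
  apply: eq_integral => y _; rewrite /h /fst /snd.
  by rewrite (gaussian_disintegration _ _ t0 r0 r2) mulrA EFinM.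
rewrite ge0_integralZl.
- by rewrite integral_normal_pdf mule1.
- exact: measurableT.
- by apply/measurable_EFinP; exact: measurable_normal_pdf.
- by move=> y _; rewrite lee_fin normal_pdf_ge0.
- by rewrite lee_fin mulr_ge0.
Qed.

Definition gauss_abs3 : R := gint (fun z => `|z| ^+ 3).

(** The expansion is integrated at [h = s * z]: the mean 0 removes the first-order term and the
    variance 1 fixes the second. [f1] and [f2] are explicit, so that the same pair serves in
    [fin_op_taylor3]. *)
Lemma gauss_op_taylor3 (C L s : R) f : 0 <= s -> unit_lipschitz L f ->
  forall f1 f2 : R -> R, (forall x h,
    `|f (x + h) - f x - h * f1 x - h ^+ 2 / 2 * f2 x| <= C * `|h| ^+ 3) ->
  forall x, `|gauss_op s f x - f x - s ^+ 2 / 2 * f2 x| <= C * (s ^+ 3 * gauss_abs3).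
Proof.
move=> s0 fL f1 f2 fT x.
have I0 := unit_lipschitz_gintegrable s x fL.
have I1 := gintegrableZ (s * f1 x) (@gintegrable_id R).
have I2 := gintegrableZ (s ^+ 2 / 2 * f2 x) (@gintegrable_sqr R).
have I3 := gintegrableZ (C * s ^+ 3) (@gintegrable_cube R).
have IN g : gintegrable g -> gintegrable (fun z => - g z).
  by move/(gintegrableZ (-1)); under eq_fun do rewrite mulN1r.
have Ic := gintegrableD I0 (IN _ (gintegrable_cst (f x))).
have Id := gintegrableD Ic (IN _ I1).
have Ie := gintegrableD Id (IN _ I2).
have pw z : `|f (x + s * z) - f x - s * f1 x * z - s ^+ 2 / 2 * f2 x * z ^+ 2|
    <= C * s ^+ 3 * `|z| ^+ 3.
  have := fT x (s * z); rewrite normrM (exprMn 3) (ger0_norm s0) (exprMn 2).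
  rewrite (mulrA C).
  have -> : s ^+ 2 / 2 * f2 x * z ^+ 2 = s ^+ 2 * z ^+ 2 / 2 * f2 x by ring.
  by have -> : s * f1 x * z = s * z * f1 x by ring.
have := ler_norm_gint Ie I3 pw.
rewrite (gintB Id I2) (gintB Ic I1) (gintB I0 (gintegrable_cst _)).
rewrite (gintZ _ (@gintegrable_sqr R)) (gintZ _ (@gintegrable_id R)).
rewrite (gintZ _ (@gintegrable_cube R)) gint_id gint_sqr gint_cst.
by rewrite mulr0 subr0 mulr1 -[leRHS]mulrA.
Qed.

End gaussian_operator.

(** * Replacing the summands by Gaussians *)

Section finite_operator.
Context {R : realType} {I : finType}.
Variables p v : I -> R.
Implicit Types f g : R -> R.

Definition fin_op f x : R := \sum_i p i * f (x + v i).

Definition fin_var : R := \sum_i p i * v i ^+ 2.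
Definition fin_abs3 : R := \sum_i p i * `|v i| ^+ 3.

Hypothesis p0 : forall i, 0 <= p i.
Hypothesis p1 : \sum_i p i = 1.

Lemma fin_var_ge0 : 0 <= fin_var.
Proof. by apply: sumr_ge0 => i _; rewrite mulr_ge0 ?sqr_ge0. Qed.

Lemma le_fin_op f g : (forall x, f x <= g x) -> forall x, fin_op f x <= fin_op g x.
Proof. by move=> fg x; apply: ler_sum => i _; rewrite ler_wpM2l. Qed.

Lemma fin_op_contract f g (e : R) : (forall x, `|f x - g x| <= e) ->
  forall x, `|fin_op f x - fin_op g x| <= e.
Proof.
move=> fg x; rewrite /fin_op -sumrB.
apply: le_trans (ler_norm_sum _ _ _) _; rewrite -[leRHS]mul1r -p1 mulr_suml.
by apply: ler_sum => i _; rewrite -mulrBr normrM ger0_norm// ler_wpM2l.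
Qed.

Lemma unit_lipschitz_fin_op (L : R) f : unit_lipschitz L f ->
  unit_lipschitz L (fin_op f).
Proof.
move=> [f01 fL]; split=> [x|x y].
  apply/andP; split.
    by apply: sumr_ge0 => i _; have /andP[? _] := f01 (x + v i); rewrite mulr_ge0.
  rewrite -p1; apply: ler_sum => i _; have /andP[_ ?] := f01 (x + v i).
  by rewrite ler_piMr.
rewrite /fin_op -sumrB.
apply: le_trans (ler_norm_sum _ _ _) _; rewrite -[leRHS]mul1r -p1 mulr_suml.
apply: ler_sum => i _; rewrite -mulrBr normrM ger0_norm// ler_wpM2l//.
by apply: le_trans (fL _ _) _; have -> : x + v i - (y + v i) = x - y by ring.
Qed.

Lemma gauss_op_fin_op (L s : R) f x : unit_lipschitz L f ->
  fin_op (gauss_op s f) x = gauss_op s (fin_op f) x.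
Proof.
move=> fL; rewrite /gauss_op /fin_op.
have IF i := unit_lipschitz_gintegrable s (x + v i) fL.
have [_ <-] := gint_sum (index_enum I) p IF.
by apply: eq_gint => z; apply: eq_bigr => i _; rewrite addrAC.
Qed.

Hypothesis pv : \sum_i p i * v i = 0.

Lemma fin_op_taylor3 (C : R) f (f1 f2 : R -> R) : (forall x h,
    `|f (x + h) - f x - h * f1 x - h ^+ 2 / 2 * f2 x| <= C * `|h| ^+ 3) ->
  forall x, `|fin_op f x - f x - fin_var / 2 * f2 x| <= C * fin_abs3.
Proof.
move=> fT x; have -> : fin_op f x - f x - fin_var / 2 * f2 x =
    \sum_i p i * (f (x + v i) - f x - v i * f1 x - v i ^+ 2 / 2 * f2 x).
  transitivity (fin_op f x - (\sum_i p i) * f x - (\sum_i p i * v i) * f1 x -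
      fin_var * (f2 x / 2)).
    by rewrite p1 pv; field.
  rewrite /fin_op /fin_var !mulr_suml -!sumrB; apply: eq_bigr => i _.
  by field.
apply: le_trans (ler_norm_sum _ _ _) _; rewrite /fin_abs3 mulr_sumr.
by apply: ler_sum => i _; rewrite normrM ger0_norm// mulrCA ler_wpM2l.
Qed.

(* Average [3 s a^2 <= 2 a^3 + s^3] over [a = |v i|], with [s] the standard
   deviation. *)
Lemma fin_sd3_le : Num.sqrt fin_var ^+ 3 <= fin_abs3.
Proof.
set s := Num.sqrt _; have s0 : 0 <= s by exact: sqrtr_ge0.
have s2 : fin_var = s ^+ 2 by rewrite sqr_sqrtr// fin_var_ge0.
have : 3 * s * fin_var <= 2 * fin_abs3 + (\sum_i p i) * s ^+ 3.
  rewrite /fin_var /fin_abs3 !mulr_sumr mulr_suml -big_split/=.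
  apply: ler_sum => i _; rewrite mulrCA (mulrCA 2) -mulrDr ler_wpM2l//.
  rewrite -(real_normK (num_real (v i))).
  have a0 := normr_ge0 (v i); move: (`|v i|) a0 => a a0.
  have : 0 <= (a - s) ^+ 2 * (2 * a + s) by rewrite mulr_ge0 ?sqr_ge0//; lra.
  by lra.
rewrite p1 s2; have -> : 3 * s * s ^+ 2 = 3 * s ^+ 3 by ring.
by lra.
Qed.

(** Equal means and variances make the two expansions agree to second order. [fin_sd3_le] bounds the
    Gaussian third-order error by the third moment of the summand. *)
Lemma fin_op_gauss_op (C L : R) f : unit_lipschitz L f -> taylor3 C f ->
  forall x, `|fin_op f x - gauss_op (Num.sqrt fin_var) f x| <=
    C * (1 + gauss_abs3) * fin_abs3.
Proof.
move=> fL [f1 [f2 fT]] x.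
(* Read off the expansion at [h = 1]. *)
have C0 : 0 <= C.
  have := fT 0 1; rewrite normr1 !expr1n mulr1; apply: le_trans; exact: normr_ge0.
have M0 : 0 <= @gauss_abs3 R.
  rewrite -[leLHS](gint_cst 0); apply: le_gint; [exact: gintegrable_cst|
    exact: gintegrable_cube|move=> z; exact: exprn_ge0].
have := fin_op_taylor3 fT x.
have := gauss_op_taylor3 (sqrtr_ge0 fin_var) fL fT x.
rewrite sqr_sqrtr ?fin_var_ge0//.
have := ler_wpM2l C0 (ler_wpM2r M0 fin_sd3_le).
move: (_ ^+ 3 * _) (gauss_op _ _ _) (fin_op f x) (fin_var / 2 * _) => a b c d.
rewrite mulrDr mulrDl mulr1 -mulrA [gauss_abs3 * _]mulrC.
by rewrite !ler_norml => ? /andP[? ?] /andP[? ?]; apply/andP; split; lra.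
Qed.

End finite_operator.

(** * Lindeberg's exchange along a sequence of summands *)

Section lindeberg.
Context {R : realType} {I : nat -> finType}.
Variables p v : forall n, I n -> R.
Implicit Types f g : R -> R.

(** Summands are numbered from 1, and the operator of summand [k] is outermost. For independent
    summands this is the expectation of [f] at [x] plus the first [k] of them. *)
Fixpoint fin_ops k f : R -> R :=
  if k is k'.+1 then fin_op (@p k) (@v k) (fin_ops k' f) else f.

Hypothesis p0 : forall n, (0 < n)%N -> forall i, 0 <= @p n i.
Hypothesis p1 : forall n, (0 < n)%N -> \sum_i @p n i = 1.
Hypothesis pv : forall n, (0 < n)%N -> \sum_i @p n i * @v n i = 0.

Lemma le_fin_ops k f g : (forall x, f x <= g x) ->
  forall x, fin_ops k f x <= fin_ops k g x.
Proof. by move=> fg; elim: k => //= k IH x; apply: le_fin_op => //; exact: p0. Qed.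

(** Induction on [k]. The earlier summands are exchanged under the last operator, a contraction
    ([T1]); the last summand is then exchanged under a Gaussian average ([T2]). *)
Lemma fin_ops_gauss_op (C L : R) f k : unit_lipschitz L f -> taylor3 C f ->
  forall x, `|fin_ops k f x -
      gauss_op (Num.sqrt (\sum_(1 <= n < k.+1) fin_var (@p n) (@v n))) f x| <=
    C * (1 + gauss_abs3) * \sum_(1 <= n < k.+1) fin_abs3 (@p n) (@v n).
Proof.
move=> fL fT; elim: k => [x|k IH x].
  by rewrite !big_geq// sqrtr0 gauss_op0 subrr normr0 mulr0.
rewrite [X in Num.sqrt X]big_nat_recr//= [X in _ * X]big_nat_recr//=.
set V := \sum_(1 <= n < k.+1) fin_var _ _ in IH *.
set w := fin_var _ _.
have p0k := @p0 k.+1 isT; have p1k := p1 (ltn0Sn k); have pvk := pv (ltn0Sn k).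
have V0 : 0 <= V.
  by rewrite /V big_nat sumr_ge0// => n /andP[n1 _]; apply: fin_var_ge0; exact: p0.
have w0 : 0 <= w by exact: fin_var_ge0.
have -> : gauss_op (Num.sqrt (V + w)) f x =
    gauss_op (Num.sqrt V) (gauss_op (Num.sqrt w) f) x.
  (* The semigroup law asks for a positive inner deviation, so a degenerate summand is treated
     apart. *)
  have [ws|ws] := eqVneq w 0.
    rewrite ws addr0 sqrtr0; apply: eq_gint => z; by rewrite gauss_op0.
  rewrite (gauss_op_semigroup _ _ _ fL) ?sqrtr_gt0 ?lt_def ?ws//.
  by rewrite !sqr_sqrtr.
have T1 := fin_op_contract (@v k.+1) p0k p1k IH x.
have T2 : `|gauss_op (Num.sqrt V) (fin_op (@p k.+1) (@v k.+1) f) x -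
    gauss_op (Num.sqrt V) (gauss_op (Num.sqrt w) f) x| <=
    C * (1 + gauss_abs3) * fin_abs3 (@p k.+1) (@v k.+1).
  have L1 := unit_lipschitz_fin_op (@v k.+1) p0k p1k fL.
  have L2 := unit_lipschitz_gauss_op (Num.sqrt w) fL.
  have I1 := unit_lipschitz_gintegrable (Num.sqrt V) x L1.
  have I2 := unit_lipschitz_gintegrable (Num.sqrt V) x L2.
  rewrite /gauss_op -gintB// -[leRHS]gint_cst; apply: ler_norm_gint.
  - have := gintegrableD I1 (gintegrableZ (-1) I2).
    by under eq_fun do rewrite mulN1r.
  - exact: gintegrable_cst.
  - by move=> z; apply: (fin_op_gauss_op p0k p1k pvk fL fT).
rewrite mulrDr; apply: le_trans (lerD T1 T2).
(* Commuting the operators lets the one-step comparison act on [f] itself, whose expansion is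
   known. *)
rewrite (gauss_op_fin_op _ _ _ _ fL).
by apply: le_trans (ler_normD _ _); rewrite addrA subrK.
Qed.

End lindeberg.

(** * Sums of independent finitely valued variables *)

Section finitely_valued.
Context {d : measure_display} {T : measurableType d} {R : realType}.
Variable P : probability T R.

Lemma measurable_finite_preimage (I : finType) (X : T -> I) (E : set I) :
  (forall i, measurable [set t | X t = i]) -> measurable [set t | E (X t)].
Proof.
move=> mX; have -> : [set t | E (X t)] = \bigcup_(i in E) [set t | X t = i].
  by apply/seteqP; split=> [t /= Et|t [i Ei /= ->]//]; exists (X t).
by apply: fin_bigcup_measurable => //; exact: finite_finset.
Qed.

Lemma measurable_fun_finite (I : finType) (X : T -> I) (g : I -> R) :
  (forall i, measurable [set t | X t = i]) ->
  measurable_fun setT (fun t => g (X t)).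
Proof.
move=> mX _ B mB; rewrite setTI.
exact: (measurable_finite_preimage (g @^-1` B) mX).
Qed.

Lemma expectation_finite (I : finType) (X : T -> I) (g : I -> R) :
  (forall i, measurable [set t | X t = i]) ->
  'E_P[fun t => g (X t)]%E = (\sum_i fine (P [set t | X t = i]) * g i)%:E.
Proof.
move=> mX; rewrite unlock.
have -> : (fun t => (g (X t))%:E) =
    (fun t => \sum_i ((g i)%:E * (\1_[set t | X t = i] t)%:E))%E.
  apply/funext => t; rewrite (bigD1 (X t))//= big1 => [|i iX].
    by rewrite indicE mem_set// mule1 adde0.
  by rewrite indicE memNset ?mule0//= => Xi; rewrite Xi eqxx in iX.
have I1 i : P.-integrable setT (fun t => (\1_[set t | X t = i] t)%:E).
  exact: integrable_indic.
rewrite integral_sum//; last by move=> i; exact: integrableZl.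
rewrite -sumEFin; apply: eq_bigr => i _; rewrite integralZl// integral_indic//.
by rewrite setIT EFinM fineK ?fin_num_measure// muleC.
Qed.

Lemma measure_finite_split (I : finType) (X : T -> I) (A : set T) :
  (forall i, measurable [set t | X t = i]) -> measurable A ->
  P A = (\sum_i P (A `&` [set t | X t = i]))%E.
Proof.
move=> mX mA; have mAX i : measurable (A `&` [set t | X t = i]) by exact: measurableI.
transitivity (\int[P]_t \sum_i (\1_(A `&` [set t | X t = i]) t)%:E)%E.
  rewrite -[A in LHS]setIT -integral_indic//; apply: eq_integral => t _.
  rewrite (bigD1 (X t))//= big1 => [|i iX].
    by rewrite adde0 !indicE in_setI (@mem_set _ [set _ | _])// andbT.
  by rewrite indicE memNset//= => -[_ Xi]; rewrite Xi eqxx in iX.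
rewrite integral_sum//; last by move=> i; exact: integrable_indic.
by apply: eq_bigr => i _; rewrite integral_indic// setIT.
Qed.

End finitely_valued.

(** * The law of an independent sum through averaging operators *)

Section independent_sum.
Context {d : measure_display} {T : measurableType d} {R : realType}.
Variable P : probability T R.
Variables (I : nat -> finType) (S : forall n, T -> I n).
Arguments S : clear implicits.

Hypothesis mS : forall n (i : I n), (0 < n)%N -> measurable [set t | S n t = i].
Hypothesis indep : forall (J : {fset nat}) (E : forall n, set (I n)),
  (forall n, n \in J -> (0 < n)%N) ->
  P (\bigcap_(n in [set` J]) [set t | E n (S n t)]) =
    (\prod_(n <- J) P [set t | E n (S n t)])%E.

Definition mass n (i : I n) : R := fine (P [set t | S n t = i]).

(* The events indexed by [J] are carried along so that the induction can peel
   off one variable at a time. *)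
Lemma joint_law_fin_ops (v : forall n, I n -> R) (B : set R) k (x : R)
    (J : {fset nat}) (E : forall n, set (I n)) :
  measurable B -> (forall n, n \in J -> (k < n)%N) ->
  P ([set t | B (x + \sum_(1 <= n < k.+1) v n (S n t))] `&`
     \bigcap_(n in [set` J]) [set t | E n (S n t)]) =
  ((fin_ops mass v k (fun y => (y \in B)%:R) x)%:E *
   \prod_(n <- J) P [set t | E n (S n t)])%E.
Proof.
move=> mB; elim: k x J E => [|k IH] x J E kJ.
  rewrite -indep//=; under eq_set do rewrite big_geq// addr0.
  have [Bx|nBx] := pselect (B x).
    rewrite mem_set// mul1e; congr (P _); apply/seteqP; split=> t; first by case.
    by move=> Jt; split.
  rewrite memNset// mul0e (_ : _ `&` _ = set0) ?measure0//.
  by apply/seteqP; split=> t //= -[].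
have mE n : n \in J -> measurable [set t | E n (S n t)].
  move=> nJ; apply: measurable_finite_preimage => i; apply: mS.
  exact: leq_trans (kJ n nJ).
have mk i := @mS k.+1 i (ltn0Sn k).
rewrite (@measure_finite_split _ _ _ P _ (S k.+1) _ mk); last first.
  apply: measurableI.
    have mW : measurable_fun setT (fun t => x + \sum_(1 <= n < k.+2) v n (S n t)).
      apply: measurable_funD => //.
      (* Measurability is assumed only for positive indices, hence the guarded terms. *)
      rewrite (_ : (fun t => _) = (fun t => \sum_(1 <= n < k.+2)
          if (0 < n)%N then v n (S n t) else 0)); last first.
        by apply/funext => t; apply: eq_big_nat => n /andP[-> _].
      apply: measurable_sum => n; have [n0|_] := ltnP 0 n; last exact: measurable_cst.
      by apply: measurable_fun_finite => i; exact: mS.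
    by have := mW measurableT _ mB; rewrite setTI.
  by apply: fin_bigcap_measurable.
have mJ : measurable (\bigcap_(n in [set` J]) [set t | E n (S n t)]).
  by apply: fin_bigcap_measurable.
have J0 n : n \in J -> (0 < n)%N by move=> nJ; exact: leq_trans (kJ n nJ).
rewrite -[X in (_ * X)%E](indep _ J0) -(fineK (fin_num_measure P _ mJ)) -EFinM.
rewrite /= /fin_op mulr_suml -sumEFin; apply: eq_bigr => i _.
(* The event that variable [k.+1] equals [i] joins the carried family, and the induction hypothesis
   applies at the shifted point [x + v k.+1 i]. *)
pose E' : forall n, set (I n) :=
  @eqtype.dfwith nat (fun n => set (I n)) E k.+1 [set i].
have kNJ : k.+1 \notin J by apply/negP => /kJ; rewrite ltnn.
rewrite (_ : _ `&` _ =
    [set t | B (x + v k.+1 i + \sum_(1 <= n < k.+1) v n (S n t))] `&`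
    \bigcap_(n in [set` (k.+1 |` J)%fset]) [set t | E' n (S n t)]); last first.
  apply/seteqP; split=> t /=.
    move=> [[Bt Jt] Si]; split.
      by move: Bt; rewrite big_nat_recr//= Si (addrC (\sum_(_ <= _ < _) _)) addrA.
    move=> n /=; rewrite !inE => /orP[/eqP ->|nJ]; first by rewrite /E' dfwith_in.
    rewrite /E' dfwith_out; first exact: Jt.
    by apply: contraNneq kNJ => ->.
  move=> [Bt Jt]; have Si : S k.+1 t = i.
    by have := Jt k.+1; rewrite /= !inE eqxx /= /E' dfwith_in; exact.
  split=> //; split.
    by rewrite big_nat_recr//= Si (addrC (\sum_(_ <= _ < _) _)) addrA.
  move=> n /= nJ; have := Jt n; rewrite /= !inE nJ orbT /E' dfwith_out; first exact.
  by apply: contraNneq kNJ => ->.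
rewrite IH; last first.
  move=> n; rewrite !inE => /orP[/eqP ->//|nJ]; exact: ltnW (kJ n nJ).
rewrite big_fsetU1//= {1}/E' dfwith_in.
rewrite (eq_big_seq (fun n => P [set t | E n (S n t)])); last first.
  move=> n nJ; rewrite /E' dfwith_out//; by apply: contraNneq kNJ => ->.
rewrite -(indep _ J0) (_ : [set t | [set i] (S k.+1 t)] = [set t | S k.+1 t = i])//.
rewrite -[in LHS](fineK (fin_num_measure P _ mJ)).
rewrite -[P [set t | S k.+1 t = i]](fineK (fin_num_measure P _ (mk i))).
by rewrite -!EFinM -/(mass i) mulrA [fin_ops _ _ _ _ _ * _]mulrC.
Qed.

Lemma law_sum_fin_ops (v : forall n, I n -> R) (B : set R) k : measurable B ->
  P [set t | B (\sum_(1 <= n < k.+1) v n (S n t))] =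
  (fin_ops mass v k (fun y => (y \in B)%:R) 0)%:E.
Proof.
move=> mB; have := @joint_law_fin_ops v B k 0 fset0 (fun=> setT) mB.
rewrite big_seq_fset0 mule1 => <-; last by move=> n; rewrite inE.
congr (P _); apply/seteqP; split=> t /=; rewrite add0r //; by case.
Qed.

End independent_sum.

(** * Lyapunov's theorem *)

Section normal_cdf.
Context {R : realType}.

Lemma gintegrable_le (c : R) : gintegrable (fun z : R => (z <= c)%R%:R).
Proof.
apply: (le_gintegrable _ _ (gintegrable_cst 1)); last first.
  by move=> z; case: (z <= c); rewrite ?normr1 ?normr0.
rewrite (_ : (fun z : R => _) = \1_(`]-oo, c]%classic)).
  by apply: measurable_indic.
by apply/funext => z; rewrite indicE; congr (_%:R); rewrite mem_setE in_itv.
Qed.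

Lemma normal_prob_itvNyc (c : R) :
  normal_prob 0 1 `]-oo, c]%classic = (gint (fun z : R => (z <= c)%R%:R))%:E.
Proof.
rewrite /gint /Rintegral fineK; last exact: integrable_fin_num (gintegrable_le c).
rewrite /normal_prob [LHS]integral_mkcond; apply: eq_integral => z _.
rewrite patchE mem_setE in_itv /=; case: (z <= c); first by rewrite mul1r.
by rewrite mul0r.
Qed.

Lemma gauss_op_step_le (c e : R) : 0 < e ->
  gauss_op 1 (step_at c e) 0 <= gint (fun z : R => (z <= c)%R%:R).
Proof.
move=> e0; apply: le_gint.
- exact: (unit_lipschitz_gintegrable _ _ (step_at_lip c e0)).
- exact: gintegrable_le.
- by move=> z; rewrite add0r mul1r; exact: step_at_le.
Qed.

Lemma gauss_op_step_ge (c e : R) : 0 < e ->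
  gint (fun z : R => (z <= c - 3 * e)%R%:R) <= gauss_op 1 (step_at c e) 0.
Proof.
move=> e0; apply: le_gint.
- exact: gintegrable_le.
- exact: (unit_lipschitz_gintegrable _ _ (step_at_lip c e0)).
- by move=> z; rewrite add0r mul1r; exact: step_at_ge.
Qed.

End normal_cdf.

(** * Central limit theorem for finitely valued summands *)

Section lyapunov_clt.
Context {d : measure_display} {T : measurableType d} {R : realType}.
Variable P : probability T R.
Variables (I : nat -> finType) (S : forall n, T -> I n) (y : forall n, I n -> R).
Arguments S : clear implicits.
Arguments y : clear implicits.

Hypothesis mS : forall n (i : I n), (0 < n)%N -> measurable [set t | S n t = i].

Let Y n t : R := y n (S n t).
Local Notation p := (mass P S).
Local Notation m n := (mean P (Y n)).
Local Notation s := (std_dev_sum P Y).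

Lemma mass_ge0 n : (0 < n)%N -> forall i : I n, 0 <= p i.
Proof. by move=> n0 i; rewrite fine_ge0. Qed.

Lemma mass_sum1 n : (0 < n)%N -> \sum_(i : I n) p i = 1.
Proof.
move=> n0; have mi i := mS i n0.
have := expectation_finite P (fun=> 1) mi; rewrite expectation_cst => -[] ->.
by apply: eq_bigr => i _; rewrite mulr1.
Qed.

Lemma mean_finite n : (0 < n)%N -> m n = \sum_(i : I n) p i * y n i.
Proof. by move=> n0; rewrite /mean (expectation_finite P (y n)) // => i; exact: mS. Qed.

Lemma variance_finite n : (0 < n)%N ->
  'V_P[Y n]%E = (\sum_(i : I n) p i * (y n i - m n) ^+ 2)%:E.
Proof.
move=> n0; rewrite /variance unlock.
rewrite -(expectation_finite P (fun i => (y n i - m n) ^+ 2)); last first.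
  by move=> i; exact: mS.
by congr ('E_P[_])%E; apply/funext => t; rewrite expr2.
Qed.

Lemma std_dev_sum_sqr N : s N ^+ 2 =
  \sum_(1 <= n < N.+1) \sum_(i : I n) p i * (y n i - m n) ^+ 2.
Proof.
rewrite sqr_sqrtr; last by apply: sumr_ge0 => n _; rewrite fine_ge0// variance_ge0.
by apply: eq_big_nat => n /andP[n0 _]; rewrite variance_finite.
Qed.

Lemma lyapunov_ratio_finite delta N : lyapunov_ratio P Y delta N =
  ((s N ^+ (2 + delta))^-1 *
   \sum_(1 <= n < N.+1) \sum_(i : I n) p i * `|y n i - m n| ^+ (2 + delta))%:E.
Proof.
rewrite /lyapunov_ratio EFinM -sumEFin; congr (_ * _)%E.
apply: eq_big_nat => n /andP[n0 _].
rewrite -(expectation_finite P (fun i => `|y n i - m n| ^+ (2 + delta)))//.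
by move=> i; exact: mS.
Qed.

Hypothesis indep : forall (J : {fset nat}) (E : forall n, set (I n)),
  (forall n, n \in J -> (0 < n)%N) ->
  P (\bigcap_(n in [set` J]) [set t | E n (S n t)]) =
    (\prod_(n <- J) P [set t | E n (S n t)])%E.

Let v N n (i : I n) : R := (y n i - m n) / s N.

Lemma normalized_sum_cdf N (c : R) :
  P [set t | normalized_sum P Y N t <= c] =
  (fin_ops p (v N) N (fun z => (z <= c)%R%:R) 0)%:E.
Proof.
have := law_sum_fin_ops mS indep (v N) N (measurable_itv `]-oo, c]).
rewrite (_ : (fun z : R => _) = (fun z : R => (z <= c)%R%:R)); last first.
  by apply/funext => z; rewrite mem_setE in_itv.
have E t : normalized_sum P Y N t = \sum_(1 <= n < N.+1) v N (S n t).
  by rewrite /normalized_sum mulr_sumr; apply: eq_bigr => n _; rewrite mulrC.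
by move=> <-; congr (P _); apply/seteqP; split=> t /=; rewrite in_itv /= E.
Qed.

(** After division by [s N] the variances add up to 1 and the third absolute moments to the Lyapunov
    ratio of order 1. *)
Lemma normalized_sum_cdf_gauss N (c e : R) : 0 < s N -> 0 < e ->
  `|fin_ops p (v N) N (step_at c e) 0 - gauss_op 1 (step_at c e) 0| <=
  2 * e ^- 3 * (1 + gauss_abs3) * fine (lyapunov_ratio P Y 1 N).
Proof.
move=> s0 e0.
have pv n : (0 < n)%N -> \sum_(i : I n) p i * v N i = 0.
  move=> n0; under eq_bigr do rewrite mulrA mulrBr.
  by rewrite -mulr_suml sumrB -mulr_suml mass_sum1// mul1r -mean_finite// subrr mul0r.
have := fin_ops_gauss_op mass_ge0 mass_sum1 pv N (step_at_lip c e0)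
  (step_at_taylor3 c e0) 0.
rewrite lyapunov_ratio_finite /=.
have -> : \sum_(1 <= n < N.+1) fin_var (@mass _ _ _ P I S n) (@v N n) = 1.
  transitivity (s N ^- 2 * s N ^+ 2); last by rewrite mulVf// expf_neq0// lt0r_neq0.
  rewrite [X in _ * X]std_dev_sum_sqr mulr_sumr; apply: eq_bigr => n _.
  rewrite mulr_sumr; apply: eq_bigr => i _.
  by rewrite /v exprMn exprVn mulrA [RHS]mulrC.
rewrite sqrtr1.
have -> : \sum_(1 <= n < N.+1) fin_abs3 (@mass _ _ _ P I S n) (@v N n) =
    (s N ^+ (2 + 1))^-1 * \sum_(1 <= n < N.+1)
      \sum_(i : I n) p i * `|y n i - m n| ^+ (2 + 1); last by [].
rewrite mulr_sumr; apply: eq_bigr => n _; rewrite mulr_sumr; apply: eq_bigr => i _.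
by rewrite /v normrM exprMn normfV (gtr0_norm s0) exprVn mulrA [RHS]mulrC.
Qed.

(** The steps [step_at c h] and [step_at (c + 3 * h) h] enclose the indicator of the half-line up to
    [c], and their Gaussian averages lie between [F (c - 3 * h)] and [F (c + 3 * h)]. Half of [e]
    pays for the exchange, half for the variation of [F]. *)
Theorem lyapunov_clt :
  (\forall N \near \oo, 0 < s N) ->
  lyapunov_ratio P Y 1 N @[N --> \oo] --> 0%E ->
  cvg_in_distribution P (normalized_sum P Y) (normal_prob 0 1).
Proof.
move=> s0 L0 c cont; pose K : R := 2 * (1 + gauss_abs3).
pose F (z : R) : R := gint (fun x : R => (x <= z)%R%:R).
(* This is the continuity assumption in [cvg_in_distribution]. *)
have contF : F z @[z --> c] --> F c.
  have : (F z)%:E @[z --> c] --> (F c)%:E.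
    rewrite /F -normal_prob_itvNyc.
    by under eq_fun do rewrite -normal_prob_itvNyc; exact: cont.
  by move/fine_cvgP => [].
suff : P [set t | normalized_sum P Y N t <= c] @[N --> \oo] --> (F c)%:E.
  by rewrite /F -normal_prob_itvNyc.
under eq_fun do rewrite normalized_sum_cdf.
apply: cvg_EFin; first by near=> N.
apply/cvgrPdist_le => e e0.
have e20 : 0 < e / 2 by rewrite divr_gt0.
have /cvgrPdist_le/(_ _ e20)[eta /= eta0 Feta] := contF.
(* The shift [3 * h] is half of [eta], strictly inside the continuity radius; [h] is fixed before
   [N], so [h ^- 3] is a constant in the limit. *)
pose h := eta / 6; have h0 : 0 < h by rewrite divr_gt0.
have L0' : fine (lyapunov_ratio P Y 1 N) @[N --> \oo] --> (0 : R).
  by move/fine_cvgP : L0 => [].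
have err : K * h ^- 3 * fine (lyapunov_ratio P Y 1 N) @[N --> \oo] --> (0 : R).
  rewrite -[X in _ --> X](mulr0 (K * h ^- 3)); apply: cvgM => //; exact: cvg_cst.
near=> N.
have sN : 0 < s N by near: N.
have errN : K * h ^- 3 * fine (lyapunov_ratio P Y 1 N) <= e / 2.
  by near: N; apply: (cvgr_le 0 err).
have ball_eta k : `|k| = 3 * h -> `|F c - F (c + k)| <= e / 2.
  move=> kh; apply: Feta; rewrite /ball_ /= opprD addrA subrr sub0r normrN kh /h.
  by lra.
have := ball_eta (3 * h); rewrite gtr0_norm ?mulr_gt0// => /(_ erefl) up.
have := ball_eta (- (3 * h)); rewrite normrN gtr0_norm ?mulr_gt0// => /(_ erefl) lo.
have := normalized_sum_cdf_gauss c sN h0.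
have := normalized_sum_cdf_gauss (c + 3 * h) sN h0.
have KE : 2 * h ^- 3 * (1 + gauss_abs3) = K * h ^- 3 by rewrite /K; ring.
rewrite !KE.
have := gauss_op_step_le (c + 3 * h) h0; have := gauss_op_step_ge c h0.
have := le_fin_ops (v N) mass_ge0 N (fun x => step_at_le c x h0) 0.
have := le_fin_ops (v N) mass_ge0 N (fun x => step_at_ge (c + 3 * h) x h0) 0.
rewrite addrK -/(F _) -/(F (c + 3 * h)).
move: errN up lo; rewrite !ler_norml /=.
move: (K * _ * _) (fin_ops _ _ _ _ _) (fin_ops _ _ _ _ _) (fin_ops _ _ _ _ _)
  (gauss_op _ _ _) (gauss_op _ _ _) (F c) (F _) (F _) => E1 A1 A2 A3 G1 G2 F1 F2 F3.
move=> ? /andP[? ?] /andP[? ?] ? ? ? ? /andP[? ?] /andP[? ?].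
by apply/andP; split; lra.
Unshelve. all: by end_near. Qed.

End lyapunov_clt.

(** * Central moments of bin counts *)

Section centred_binomial_sums.
Context {R : realType}.
Implicit Types g : R -> R.

Lemma sum_subsets m (G : nat -> R) :
  \sum_(B : {set 'I_m}) G #|B| = \sum_(i < m.+1) 'C(m, i)%:R * G i.
Proof.
rewrite (partition_big (fun B : {set 'I_m} => inord #|B| : 'I_m.+1) xpredT)//=.
have cB (B : {set 'I_m}) : (#|B| < m.+1)%N.
  by rewrite ltnS; apply: leq_trans (max_card _) _; rewrite card_ord.
apply: eq_bigr => i _.
have <- : #|[set B : {set 'I_m} | #|B| == i]%SET| = 'C(m, i).
  by rewrite card_draws card_ord.
rewrite (eq_bigl (mem [set B : {set 'I_m} | #|B| == i]%SET)); last first.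
  by move=> B; rewrite !inE -val_eqE /= inordK.
rewrite (eq_bigr (fun=> G i)) => [|B]; last by move=> /[!finset.inE] /eqP ->.
by rewrite sumr_const mulr_natl.
Qed.

(* The sum over the [2 ^ m] outcomes of [m] fair signs of [g] at their total. *)
Definition bsum m g : R :=
  \sum_(i < m.+1) 'C(m, i)%:R * g (2 * i%:R - m%:R).

(** Pascal's rule, read as conditioning on the last sign; the moments below follow by induction on
    [m]. *)
Lemma bsumS m g : bsum m.+1 g = bsum m (fun u => g (u - 1) + g (u + 1)).
Proof.
rewrite /bsum; under [RHS]eq_bigr do rewrite mulrDr.
rewrite big_split /= [in LHS]big_ord_recl /=.
under [X in _ + X = _]eq_bigr do rewrite binS natrD mulrDl.
rewrite big_split /= addrA; congr (_ + _); last first.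
  apply: eq_bigr => i _; congr (_ * g _); rewrite /bump /= add1n -!natr1; ring.
transitivity (\sum_(i < m.+2) 'C(m, i)%:R * g (2 * i%:R - m.+1%:R)).
  by rewrite [RHS]big_ord_recl /= !bin0; congr (_ + _); apply: eq_bigr.
rewrite big_ord_recr /= bin_small// mul0r addr0.
by apply: eq_bigr => i _; congr (_ * g _); rewrite -!natr1; ring.
Qed.

Lemma bsumD m g1 g2 : bsum m (fun u => g1 u + g2 u) = bsum m g1 + bsum m g2.
Proof. by rewrite /bsum -big_split; apply: eq_bigr => i _; rewrite mulrDr. Qed.

Lemma bsumZ m (k : R) g : bsum m (fun u => k * g u) = k * bsum m g.
Proof. by rewrite /bsum mulr_sumr; apply: eq_bigr => i _; rewrite mulrCA. Qed.

Lemma eq_bsum m g1 g2 : g1 =1 g2 -> bsum m g1 = bsum m g2.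
Proof. by move=> /funext ->. Qed.

Lemma bsum_1 m : bsum m (fun=> 1) = 2 ^+ m.
Proof.
elim: m => [|m IH]; first by rewrite /bsum big_ord1 bin0 mulr1 expr0.
by rewrite bsumS bsumD IH exprS mulr2n mulrDl mul1r.
Qed.

Lemma bsum_id m : bsum m (fun u => u) = 0.
Proof.
elim: m => [|m IH]; first by rewrite /bsum big_ord1 bin0 mulr0 subrr mulr0.
rewrite bsumS (@eq_bsum m _ (fun u => 2 * u)); last by move=> u; ring.
by rewrite bsumZ IH mulr0.
Qed.

Lemma bsum_sqr m : bsum m (fun u => u ^+ 2) = m%:R * 2 ^+ m.
Proof.
elim: m => [|m IH]; first by rewrite /bsum big_ord1 mulr0 subrr expr0n mulr0 mul0r.
rewrite bsumS (@eq_bsum m _ (fun u => 2 * u ^+ 2 + 2 * 1)); last by move=> u; ring.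
by rewrite bsumD !bsumZ IH bsum_1 exprS -natr1; ring.
Qed.

Lemma bsum_pow4 m :
  bsum m (fun u => u ^+ 4) = (3 * m%:R ^+ 2 - 2 * m%:R) * 2 ^+ m.
Proof.
elim: m => [|m IH].
  by rewrite /bsum big_ord1 mulr0 subrr !expr0n !mulr0 subrr mul0r.
rewrite bsumS (@eq_bsum m _ (fun u => 2 * u ^+ 4 + (12 * u ^+ 2 + 2 * 1))).
  by rewrite !bsumD !bsumZ IH bsum_sqr bsum_1 (exprS 2 m) -[m.+1%:R]natr1; ring.
by move=> u; ring.
Qed.

End centred_binomial_sums.

(** * Moments of a uniform subset, the full set being allowed or not *)

Section subset_weights.
Context {R : realType}.
Variables (m : nat) (q : {set 'I_m} -> R) (w : R) (full : bool).
Hypothesis qE : forall B, q B = if full || (#|B| < m)%N then w else 0.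
Hypothesis q1 : \sum_B q B = 1.
Hypothesis m0 : (0 < m)%N.
Hypothesis fullP : full || (1 < m)%N.

(** [eps] counts the excluded subsets, so [D] is the number of admissible ones. *)
Let eps : R := (~~ full)%:R.
Let D : R := 2 ^+ m - eps.

Let sum_q (G : nat -> R) :
  \sum_B q B * G #|B| = w * (\sum_(B : {set 'I_m}) G #|B| - eps * G m).
Proof.
have cT : #|[set: 'I_m]%SET| = m by rewrite cardsT card_ord.
have ltm (B : {set 'I_m}) : B != [set: 'I_m]%SET -> (#|B| < m)%N.
  by move=> BT; rewrite -[in ltnRHS]cT; apply: proper_card; rewrite properT.
rewrite (bigD1 [set: 'I_m]%SET)//= [in RHS](bigD1 [set: 'I_m]%SET)//=.
rewrite cT qE cT ltnn orbF.
rewrite (eq_bigr (fun B : {set 'I_m} => w * G #|B|)) => [|B BT]; last first.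
  by rewrite qE ltm// orbT.
by rewrite -mulr_sumr /eps; case: full => /=; ring.
Qed.

Let sum_qc (g : R -> R) : \sum_B q B * g (2 * #|B|%:R - m%:R) =
  w * (bsum m g - eps * g m%:R).
Proof.
rewrite (sum_q (fun k => g (2 * k%:R - m%:R))).
rewrite (sum_subsets m (fun k => g (2 * k%:R - m%:R))).
by congr (_ * (_ - _ * g _)); ring.
Qed.

Let wD : w * D = 1.
Proof.
have := sum_qc (fun=> 1); rewrite bsum_1 mulr1 => <-; rewrite -[RHS]q1.
by apply: eq_bigr => B _; rewrite /= mulr1.
Qed.

Let m_le : m%:R + 1 <= 2 ^+ m :> R.
Proof. by rewrite natr1 -natrX ler_nat ltn_expl. Qed.

Let m1 : 1 <= m%:R :> R. Proof. by rewrite ler1n. Qed.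

(** The bound on [D] is an equality at [m = 2], the smallest bin that can exclude its full set. *)
Let epsP : eps = 0 \/ (eps = 1 /\ (2 : R) <= m%:R /\ 3 / 2 * m%:R <= D).
Proof.
rewrite /D /eps; move: fullP; case: full => [_|/= m2]; [by left|right].
split=> //; split; first by rewrite ler_nat.
case: m m2 => [|[|k]]// _; elim: k => [|k IH]; first by rewrite expr2; lra.
have x1 : 1 <= k.+2%:R :> R by rewrite ler1n.
by rewrite (exprS 2 k.+2) -[k.+3%:R]natr1; lra.
Qed.

Let w0 : 0 < w.
Proof.
have D0 : 0 < D by rewrite /D; case: epsP => [->|[_ [_ h]]]; have := m1;
  [have := m_le|move: h; rewrite /D]; lra.
by rewrite -(pmulr_lgt0 _ D0) wD.
Qed.

(** Excluding one subset at most doubles the weight of the others. *)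
Let w2 : w * 2 ^+ m <= 2.
Proof.
have : D + eps = 2 ^+ m by rewrite subrK.
move=> <-; rewrite mulrDr wD.
have : w * 1 <= w * D.
  rewrite ler_pM2l// /D; have := m_le; have := m1.
  by case: epsP => [->|[-> _]]; lra.
by rewrite wD mulr1; case: epsP => [->|[-> _]]; rewrite ?mulr0 ?mulr1; lra.
Qed.

Definition wmean : R := \sum_B q B * #|B|%:R.

(** A sum of [m] signs, with mean [c]: the bias caused by the excluded set. *)
Let U (B : {set 'I_m}) : R := 2 * #|B|%:R - m%:R.
Let c : R := - (w * eps * m%:R).

Let q_ge0 B : 0 <= q B. Proof. by rewrite qE; case: ifP => // _; exact: ltW. Qed.

Let sumU : \sum_B q B * U B = c.
Proof. by rewrite (sum_qc (fun u => u)) bsum_id /c; ring. Qed.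

Let wmeanE : wmean = (c + m%:R) / 2.
Proof.
have : \sum_B q B * U B = 2 * wmean - m%:R * \sum_B q B.
  rewrite /wmean !mulr_sumr -sumrB; apply: eq_bigr => B _; rewrite /U; ring.
by rewrite sumU q1; lra.
Qed.

Let dev (B : {set 'I_m}) : #|B|%:R - wmean = (U B - c) / 2.
Proof. by rewrite wmeanE /U; lra. Qed.

Let c_bound : c = 0 /\ eps = 0 \/ (2 : R) <= m%:R /\ eps = 1 /\ - (2 / 3) <= c <= 0.
Proof.
rewrite /c; case: epsP => [->|[-> [m2 mD]]]; first by left; split=> //; ring.
right; do 2!split=> //; rewrite mulr1.
have : w * (3 / 2 * m%:R) <= w * D by rewrite ler_pM2l.
by rewrite wD => ?; have := mulr_ge0 (ltW w0) (ler0n R m) => ?; apply/andP; split; lra.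
Qed.

Let sum_dev2 : \sum_B q B * (#|B|%:R - wmean) ^+ 2 =
  (w * (m%:R * 2 ^+ m - eps * m%:R ^+ 2) - c ^+ 2) / 4.
Proof.
transitivity ((\sum_B q B * U B ^+ 2 - 2 * c * (\sum_B q B * U B) +
    c ^+ 2 * \sum_B q B) / 4).
  rewrite !mulr_sumr -sumrB -big_split /= mulr_suml; apply: eq_bigr => B _.
  by rewrite dev; field.
by rewrite sumU q1 (sum_qc (fun u => u ^+ 2)) bsum_sqr; field.
Qed.

(** Four times the variance is [m + c * (m - 1) - c ^+ 2]. Since [c] is 0 or lies between
    [- (2 / 3)] and 0, this is at least [m / 3], more than enough. *)
Lemma wvar_lower : m%:R / 16 <= \sum_B q B * (#|B|%:R - wmean) ^+ 2.
Proof.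
rewrite sum_dev2.
have -> : w * (m%:R * 2 ^+ m - eps * m%:R ^+ 2) =
    m%:R * (w * D) - (w * eps * m%:R) * (m%:R - 1) by rewrite /D; ring.
rewrite wD -[w * eps * m%:R]opprK -/c mulr1.
case: c_bound => [[-> _]|[m2 [_ /andP[c1 c2]]]]; first by have := m1; lra.
by have := m1; nra.
Qed.

Lemma wvar_upper : \sum_B q B * (#|B|%:R - wmean) ^+ 2 <= m%:R.
Proof.
rewrite sum_dev2; have := ler_wpM2l (ler0n R m) w2.
have : 0 <= w * (eps * m%:R ^+ 2).
  by rewrite mulr_ge0 ?(ltW w0)// mulr_ge0 ?exprn_ge0 ?ler0n.
have := sqr_ge0 c; rewrite mulrBr (mulrCA w m%:R); have := m1; lra.
Qed.

Lemma wpow4_upper : \sum_B q B * (#|B|%:R - wmean) ^+ 4 <= 4 * m%:R ^+ 2.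
Proof.
apply: (@le_trans _ _ ((\sum_B q B * U B ^+ 4 + c ^+ 4 * \sum_B q B) / 2)).
  rewrite mulr_sumr -big_split /= mulr_suml; apply: ler_sum => B _.
  rewrite (mulrC (c ^+ 4)) -mulrDr -mulrA ler_wpM2l// dev.
  move: (U B) => u; have -> : ((u - c) / 2) ^+ 4 = (u - c) ^+ 4 / 16 by field.
  (* Convexity of the fourth power as an identity, the subtracted quadratic form being
     nonnegative. *)
  have -> : (u - c) ^+ 4 = 8 * (u ^+ 4 + c ^+ 4) - (u + c) ^+ 2 *
    (7 * u ^+ 2 - 10 * u * c + 7 * c ^+ 2) by ring.
  have h7 : 0 <= 7 * u ^+ 2 - 10 * u * c + 7 * c ^+ 2.
    by have := sqr_ge0 (u - c); have := sqr_ge0 u; have := sqr_ge0 c; lra.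
  by have := mulr_ge0 (sqr_ge0 (u + c)) h7; lra.
rewrite (sum_qc (fun u => u ^+ 4)) bsum_pow4 q1 mulr1.
have c4 : c ^+ 4 <= 1.
  case: c_bound => [[-> _]|[_ [_ /andP[c1 c2]]]]; first by rewrite expr0n.
  have -> : c ^+ 4 = (- c) ^+ 4 by ring.
  by apply: exprn_ile1; lra.
have : 0 <= w * (eps * m%:R ^+ 4).
  by rewrite mulr_ge0 ?(ltW w0)// mulr_ge0 ?exprn_ge0 ?ler0n.
have k0 : 0 <= 3 * m%:R ^+ 2 - 2 * m%:R :> R by have := m1; nra.
have := ler_wpM2l k0 w2.
have -> : w * ((3 * m%:R ^+ 2 - 2 * m%:R) * 2 ^+ m - eps * m%:R ^+ 4) =
  (3 * m%:R ^+ 2 - 2 * m%:R) * (w * 2 ^+ m) - w * (eps * m%:R ^+ 4) by ring.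
move: (w * (eps * _)) ((3 * m%:R ^+ 2 - 2 * m%:R) * (w * _)) => e1 e2.
by have := m1; have := sqr_ge0 (m%:R : R); lra.
Qed.

Lemma wdev_le (B : {set 'I_m}) : `|#|B|%:R - wmean| <= m%:R.
Proof.
have cB (C : {set 'I_m}) : #|C|%:R <= m%:R :> R.
  by rewrite ler_nat; apply: leq_trans (max_card _) _; rewrite card_ord.
have : 0 <= wmean by apply: sumr_ge0 => C _; rewrite mulr_ge0.
have : wmean <= m%:R.
  rewrite -[leRHS]mul1r -[X in _ <= X * _]q1 mulr_suml; apply: ler_sum => C _.
  by apply: ler_wpM2l; [exact: q_ge0|exact: cB].
rewrite ler_norml => ? ?; have := cB B; have := ler0n R #|B|.
by move=> ? ?; apply/andP; split; lra.
Qed.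

(** Of the [delta + 3] factors, [delta] are bounded by [m]; the remaining cube is interpolated
    between the second and fourth moments, contributing 1 and 4 to the constant 5. A free [r] lets
    one value serve all bins up to [N]. *)
Lemma wabs_upper (r : R) delta : 0 < r -> m%:R <= r ^+ 2 ->
  \sum_B q B * `|#|B|%:R - wmean| ^+ (2 + delta.+1) <=
  (r ^+ 2) ^+ delta * (5 * r ^+ 3).
Proof.
move=> r0 mr.
(* [|a|^3 <= r a^2 + a^4 / r] *)
apply: (@le_trans _ _ ((r ^+ 2) ^+ delta *
   \sum_B q B * (r * (#|B|%:R - wmean) ^+ 2 + (#|B|%:R - wmean) ^+ 4 / r))).
  rewrite mulr_sumr; apply: ler_sum => B _; rewrite [leRHS]mulrCA.
  apply: ler_wpM2l => //.
  have -> : (2 + delta.+1 = delta + 3)%N by rewrite addnC addSn -addnS.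
  rewrite exprD ler_pM ?exprn_ge0//.
    by rewrite lerXn2r ?nnegrE ?exprn_ge0 ?(ltW r0)//; exact: le_trans (wdev_le B) mr.
  have e4 (x : R) : x ^+ 4 = (x ^+ 2) ^+ 2 by rewrite -exprM.
  rewrite e4 -(real_normK (num_real (#|B|%:R - wmean))).
  move: (`|_|) (normr_ge0 (#|B|%:R - wmean)) => a a0; rewrite -subr_ge0.
  have -> : r * a ^+ 2 + (a ^+ 2) ^+ 2 / r - a ^+ 3 =
      a ^+ 2 / r * (r ^+ 2 + a ^+ 2 - r * a) by field; exact: lt0r_neq0.
  by rewrite mulr_ge0 ?divr_ge0 ?sqr_ge0 ?(ltW r0)//; nra.
apply: ler_wpM2l; first by rewrite exprn_ge0 ?sqr_ge0.
have -> : \sum_B q B * (r * (#|B|%:R - wmean) ^+ 2 + (#|B|%:R - wmean) ^+ 4 / r) =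
    r * (\sum_B q B * (#|B|%:R - wmean) ^+ 2) +
    (\sum_B q B * (#|B|%:R - wmean) ^+ 4) / r.
  by rewrite mulr_sumr mulr_suml -big_split; apply: eq_bigr => B _ /=; ring.
have -> : 5 * r ^+ 3 = r * r ^+ 2 + 4 * (r ^+ 2) ^+ 2 / r.
  by field; exact: lt0r_neq0.
apply: lerD; rewrite ?ler_pM2l ?ler_pM2r ?invr_gt0//.
  exact: le_trans wvar_upper mr.
apply: le_trans wpow4_upper _; rewrite ler_pM2l// lerXn2r ?nnegrE ?ler0n//.
exact: sqr_ge0.
Qed.

End subset_weights.

(** * Rates *)

Section rates.
Context {R : realType}.

Lemma cvg0_of_le_div_sqrt (u : nat -> R) (K : R) :
  (forall N, (0 < N)%N -> 0 <= u N <= K / Num.sqrt N%:R) ->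
  u N @[N --> \oo] --> (0 : R).
Proof.
move=> uK; apply/cvgrPdist_le => e e0; near=> N.
have N0 : (0 < N)%N by near: N; exact: nbhs_infty_gt.
have /andP[u0 uN] := uK N N0; rewrite sub0r normrN ger0_norm//.
apply: le_trans uN _; have sN : 0 < Num.sqrt N%:R :> R by rewrite sqrtr_gt0 ltr0n.
rewrite ler_pdivrMr// mulrC -ler_pdivrMr//.
apply: le_trans (ler_norm _) _; rewrite -sqrtr_sqr; apply: ler_wsqrtr.
by near: N; exact: nbhs_infty_ger.
Unshelve. all: by end_near. Qed.

Lemma sum_lower_quadratic (V : nat -> R) N :
  (forall n, (0 < n)%N -> n%:R / 16 <= V n) ->
  N%:R ^+ 2 / 32 <= \sum_(1 <= n < N.+1) V n.
Proof.
move=> Vn; elim: N => [|N IH]; first by rewrite big_geq// expr0n mul0r.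
rewrite big_nat_recr//=; have := Vn N.+1 (ltn0Sn N).
by rewrite -natr1; have := ler0n R N; lra.
Qed.

(** In powers of [r], the square root of [N], the numerator has degree [2 * delta + 5] and the
    denominator degree [2 * delta + 6]. The Lyapunov exponent is [delta.+1] here. *)
Lemma lyapunov_rate (s B : R) (N delta : nat) : (0 < N)%N ->
  N%:R / 6 <= s ->
  B <= N%:R * ((Num.sqrt N%:R ^+ 2) ^+ delta * (5 * Num.sqrt N%:R ^+ 3)) ->
  (s ^+ (2 + delta.+1))^-1 * B <= 5 * 6 ^+ (delta + 3) / Num.sqrt N%:R.
Proof.
move=> N0; set r := Num.sqrt _; have r0 : 0 < r by rewrite sqrtr_gt0 ltr0n.
have -> : N%:R = r ^+ 2 :> R by rewrite sqr_sqrtr// ler0n.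
have -> : (2 + delta.+1 = delta + 3)%N by rewrite addnC addSn -addnS.
move=> rs BB; have rs0 : 0 < r ^+ 2 / 6 by rewrite divr_gt0// exprn_gt0.
have s0 : 0 < s by exact: lt_le_trans rs.
rewrite mulrC ler_pdivrMr ?exprn_gt0//; apply: le_trans BB _.
have -> : r ^+ 2 * ((r ^+ 2) ^+ delta * (5 * r ^+ 3)) =
    5 * 6 ^+ (delta + 3) / r * (r ^+ 2 / 6) ^+ (delta + 3).
  rewrite (exprMn (delta + 3)) exprVn !exprD; field.
  by rewrite (lt0r_neq0 r0) expf_neq0.
apply: ler_wpM2l; first by rewrite divr_ge0 ?(ltW r0)// mulr_ge0// exprn_ge0.
by rewrite lerXn2r ?nnegrE// ltW.
Qed.

End rates.

(** * Lyapunov's condition for the bins *)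

Section bin_counts.
Context {d : measure_display} {T : measurableType d} {R : realType}.
Variables (P : probability T R) (b : nat -> nat) (A : nat -> set nat).
Variable S : forall n, T -> {set 'I_(b n)}.
Hypothesis hb : forall n, (0 < n)%N -> b n = n.
Hypothesis hA : forall n, (0 < n)%N -> A n = `I_n \/ A n = `I_n.+1.
Hypothesis hA01 : forall n, (0 < n)%N -> [set 0%N; 1%N] `<=` A n.
Hypothesis hS : random_choice P A S.

Let I n : finType := {set 'I_(b n)}.
Let p n : I n -> R := @mass d T R P I S n.
Let y n : I n -> R := fun B => #|B|%:R.

Let mS n (B : I n) : (0 < n)%N -> measurable [set t | S n t = B].
Proof. exact: random_choice_measurable hS n B. Qed.

(** [full] records which of its two shapes [A n] has, and [w] is the common weight of the admissible
    subsets. *)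
Lemma mass_bin n : (0 < n)%N -> exists (w : R) (full : bool),
  (forall B : {set 'I_(b n)},
     p B = if full || (#|B| < b n)%N then w else 0) /\
  full || (1 < b n)%N.
Proof.
move=> n0; have U (B : {set 'I_(b n)}) := random_choice_uniform hS B n0.
move: U; set w := (_%:R)^-1 => U; exists w.
have massE (B : {set 'I_(b n)}) : p B = if #|B| \in A n then w else 0.
  by rewrite /p /mass U.
case: (hA n0) => AE; [exists false|exists true]; split=> //.
- move=> B; rewrite massE AE; move: #|B| => k; rewrite hb//=.
  by congr (if _ then _ else _); apply/idP/idP; rewrite inE.
(* Membership of 1 in [A n] rules out a bin of size 1 whose only choice is empty, which would have
   variance 0. *)
- rewrite hb//=; have /(_ 1%N) := hA01 n0; rewrite AE /= => /(_ (or_intror erefl)).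
  exact.
- move=> B; rewrite massE AE mem_set //= ltnS.
  by apply: leq_trans (max_card _) _; rewrite card_ord hb.
Qed.

Lemma bin_variance_lower n : (0 < n)%N -> n%:R / 16 <=
  \sum_(B : I n) p B * (y B - mean P (num_chosen S n)) ^+ 2.
Proof.
move=> n0; have [w [full [pE fullP]]] := mass_bin n0.
have b0 : (0 < b n)%N by rewrite hb.
have := wvar_lower pE (mass_sum1 P mS n0) b0 fullP.
by rewrite (mean_finite P y mS n0) [in X in X%:R / 16]hb.
Qed.

Lemma bin_abs_upper n (r : R) delta : (0 < n)%N -> 0 < r -> n%:R <= r ^+ 2 ->
  \sum_(B : I n) p B * `|y B - mean P (num_chosen S n)| ^+ (2 + delta.+1) <=
  (r ^+ 2) ^+ delta * (5 * r ^+ 3).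
Proof.
move=> n0 r0 nr; have [w [full [pE fullP]]] := mass_bin n0.
have b0 : (0 < b n)%N by rewrite hb.
have br : (b n)%:R <= r ^+ 2 by rewrite hb.
have := wabs_upper pE (mass_sum1 P mS n0) b0 fullP delta r0 br.
by rewrite (mean_finite P y mS n0).
Qed.

Lemma std_dev_sum_lower N : N%:R / 6 <= std_dev_sum P (num_chosen S) N.
Proof.
have s0 : 0 <= std_dev_sum P (num_chosen S) N by exact: sqrtr_ge0.
rewrite -(@ler_pXn2r _ 2)// ?nnegrE ?divr_ge0//.
rewrite (std_dev_sum_sqr P y mS).
apply: le_trans (sum_lower_quadratic N bin_variance_lower).
(* Weakening [1 / 32] to [1 / 36] makes the root rational. *)
by rewrite exprMn exprVn; have := sqr_ge0 (N%:R : R); lra.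
Qed.

Lemma lyapunov_ratio_bin delta : (0 < delta)%N ->
  lyapunov_ratio P (num_chosen S) delta N @[N --> \oo] --> 0%E.
Proof.
case: delta => // delta _.
under eq_fun do rewrite (lyapunov_ratio_finite P y mS).
apply: cvg_EFin; first by near=> N.
apply: (@cvg0_of_le_div_sqrt _ _ (5 * 6 ^+ (delta + 3))) => N N0 /=.
apply/andP; split.
  apply: mulr_ge0; first by rewrite invr_ge0 exprn_ge0// sqrtr_ge0.
  rewrite big_nat; apply: sumr_ge0 => n /andP[n0 _]; apply: sumr_ge0 => B _.
  by apply: mulr_ge0; [exact: mass_ge0|exact: exprn_ge0].
apply: (lyapunov_rate N0 (std_dev_sum_lower N)).
have r0 : 0 < Num.sqrt N%:R :> R by rewrite sqrtr_gt0 ltr0n.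
(* Every bin up to [N] gets the same bound, with [r] the square root of [N]. *)
apply: (@le_trans _ _ (\sum_(1 <= n < N.+1)
    ((Num.sqrt N%:R ^+ 2) ^+ delta * (5 * Num.sqrt N%:R ^+ 3)))); last first.
  by rewrite sumr_const_nat subSS subn0 [leRHS]mulr_natl.
rewrite !big_nat; apply: ler_sum => n /andP[n0 nN]; apply: bin_abs_upper => //.
by rewrite sqr_sqrtr ?ler0n// ler_nat.
Unshelve. all: by end_near. Qed.

End bin_counts.

Theorem theorem1p4 (b : nat -> nat) (A : nat -> set nat) (a : nat -> nat)
  (hb : forall n, (0 < n)%N -> b n = n)
  (hA : forall n, (0 < n)%N -> A n = `I_n \/ A n = `I_n.+1)
  (hA01 : forall n, (0 < n)%N -> [set 0%N; 1%N] `<=` A n)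
  (ha : bA0_sequence b A a)
  (R : realType) (d : measure_display) (T : measurableType d)
  (P : probability T R) (S : forall n, T -> {set 'I_(b n)})
  (hS : random_choice P A S)
  (Y : nat -> T -> R) (hY : Y = num_chosen S) :
  (forall delta : nat, (0 < delta)%N ->
     lyapunov_ratio P Y delta N @[N --> \oo] --> 0%E) /\
  cvg_in_distribution P (normalized_sum P Y) (normal_prob 0 1).
Proof.
have lyap := lyapunov_ratio_bin hb hA hA01 hS.
rewrite hY; split=> //.
(* Independence is given for the random subsets, so they are the finitely valued variables, and the
   counts are functions of them. *)
apply: (@lyapunov_clt _ _ _ P (fun n => {set 'I_(b n)} : finType) S
  (fun n B => #|B|%:R)) => //.
- by move=> n B; exact: random_choice_measurable hS n B.
- exact: random_choice_independent hS.
- near=> N; apply: lt_le_trans (std_dev_sum_lower hb hA hA01 hS N).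
  by rewrite divr_gt0// ltr0n; near: N; exact: nbhs_infty_gt.
- exact: lyap.
Unshelve. all: by end_near. Qed.
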